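(* Let $(Y_t,t\ge 0)$ be a CBI$(\Psi,\Phi)$ process with supercritical branching mechanism, i.e. $b<0$, and let $0<\lambda<\rho$. Then: (i) if $\int_0\frac{\Phi(u)}{|\Psi(u)|}\,\mathrm{d}u<\infty$ (integrability near $0$), then $v_{-t}(\lambda)Y_t\to W^{\lambda}$ as $t\to\infty$, $\mathbb P_x$-almost surely, where $W^\lambda$ is a nondegenerate proper random variable with, for all $\theta>0$, $$\mathbb E_x\big[e^{-\theta W^\lambda}\big]=\exp\Big(-x\,v_{-\frac{\ln\theta}{b}}(\lambda)+\int_0^{v_{-\frac{\ln\theta}{b}}(\lambda)}\frac{\Phi(u)}{\Psi(u)}\,\mathrm{d}u\Big);$$ (ii) if $\int_0\frac{\Phi(u)}{|\Psi(u)|}\,\mathrm{d}u=\infty$, then $v_{-t}(\lambda)Y_t\to\infty$ as $t\to\infty$, $\mathbb P_x$-almost surely.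
   Context: Let $\sigma\ge 0$, $b\in\mathbb R$, $\beta\ge 0$, and let $\pi,\nu$ be $\sigma$-finite measures on $(0,\infty)$ with $\int_0^\infty (z\wedge z^2)\pi(\mathrm{d}z)<\infty$ and $\int_0^\infty(1\wedge z)\nu(\mathrm{d}z)<\infty$. The branching mechanism is $\Psi(q)=bq+\frac12\sigma^2q^2+\int_0^\infty(e^{-qu}-1+qu)\pi(\mathrm{d}u)$ and the immigration mechanism is $\Phi(q)=\beta q+\int_0^\infty(1-e^{-qu})\nu(\mathrm{d}u)$, $q\ge 0$; it is assumed that $\Phi(q)>0$ for all $q>0$. For $\lambda\ge 0$, $t\mapsto v_t(\lambda)$ is the solution of $\frac{\partial}{\partial t}v_t(\lambda)=-\Psi(v_t(\lambda))$, $v_0(\lambda)=\lambda$. A CBI$(\Psi,\Phi)$ process is a $[0,\infty)$-valued Markov process $(Y_t)$ with $\mathbb E_x[e^{-\lambda Y_t}]=\exp\big(-xv_t(\lambda)-\int_0^t\Phi(v_s(\lambda))\mathrm{d}s\big)$ for all $\lambda,t\ge0$, where $\mathbb P_x,\mathbb E_x$ refer to the process started at $x\ge0$. Let $\rho=\inf\{z>0:\Psi(z)\ge 0\}$ (with $\inf\emptyset=\infty$). For $t\ge0$, $\lambda\mapsto v_t(\lambda)$ is strictly increasing; $\lambda\mapsto v_{-t}(\lambda)$ denotes its inverse (defined on $[0,\lim_{\mu\to\infty}v_t(\mu))$). Thus for $s\in\mathbb R$, $v_s$ means $v_{|s|}$ if $s\ge0$ and the inverse of $v_{|s|}$ if 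$s<0$.
   Formalization: The CBI process is taken with càdlàg paths (the standard version; without path regularity the almost sure limit as t→∞ in continuous time can fail), and ''nondegenerate'' is read as ''not almost surely zero'', since W can be a nonzero constant when Ψ and Φ are linear. *)

(* Defs.v *)
From HB Require Import structures.
From mathcomp Require Import all_boot all_order all_algebra.
From mathcomp Require Import all_classical all_reals all_analysis.
Set Implicit Arguments. Unset Strict Implicit. Unset Printing Implicit Defensive.
Import Order.TTheory GRing.Theory Num.Theory.
Import numFieldNormedType.Exports.
Local Open Scope classical_set_scope.
Local Open Scope ring_scope.

Definition Psi {R : realType} (sigma b : R) (pi : {measure set R -> \bar R}) (q : R) : R :=
  b * q + sigma ^+ 2 * q ^+ 2 / 2
  + fine (\int[pi]_(u in [set u : R | (0 < u)%R]) (expR (- (q * u)) - 1 + q * u)%:E)%E.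

Definition Phi {R : realType} (beta : R) (nu : {measure set R -> \bar R}) (q : R) : R :=
  beta * q + fine (\int[nu]_(u in [set u : R | (0 < u)%R]) (1 - expR (- (q * u)))%:E)%E.

Definition rho_of {R : realType} (Psi : R -> R) : \bar R :=
  ereal_inf [set z%:E | z in [set z : R | 0 < z /\ 0 <= Psi z]].

Definition vinv {R : realType} (v : R -> R -> R) (t lam : R) : R :=
  xget 0 [set mu : R | 0 <= mu /\ v t mu = lam].

Definition vs {R : realType} (v : R -> R -> R) (s lam : R) : R :=
  if 0 <= s then v s lam else vinv v (- s) lam.

Definition natF {d} {Omega : measurableType d} {R : realType}
  (Y : R -> Omega -> R) (s : R) : set (set Omega) :=
  <<s [set A | exists r B, 0 <= r <= s /\ measurable B /\ A = Y r @^-1` B] >>.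

(* (Y_t) is a CBI(Psi,Phi) process started at x under P:
   nonnegative cadlag paths, measurable coordinates, Y_0 = x a.s., and the
   Markov property w.r.t. the natural filtration with transition semigroup
   characterized by E_y[e^{-lam Y_t}] = exp(-y v_t(lam) - \int_0^t Phi(v_s(lam)) ds). *)
Definition is_CBI {d} {Omega : measurableType d} {R : realType}
  (P : probability Omega R) (PhiF : R -> R) (v : R -> R -> R)
  (x : R) (Y : R -> Omega -> R) : Prop :=
  [/\ forall t, measurable_fun setT (Y t),
      forall t w, 0 <= t -> 0 <= Y t w,
      (forall w t, 0 <= t -> Y^~ w @ t^'+ --> Y t w) /\
        (forall w t, 0 < t -> cvg (Y^~ w @ t^'-)),
      {ae P, forall w, Y 0 w = x} &
      forall s t lam A, 0 <= s -> 0 <= t -> 0 <= lam -> natF Y s A ->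
        (\int[P]_(w in A) (expR (- (lam * Y (s + t) w)))%:E =
         \int[P]_(w in A)
            (expR (- (Y s w * v t lam)
                   - Rintegral lebesgue_measure `[0, t] (fun r => PhiF (v r lam))))%:E)%E].

(* Main.v *)
(** The orbits of the flow [v] turn integrals of [Phi] in time into integrals of
    [Phi / |Psi|] in space: with [h t = v_{-t}(lam)] and
    [K t = \int_{h t}^{lam} Phi / |Psi|], the transition formula says that
    [exp (K t - h t * Y_t)] is a nonnegative martingale.  If [K] is bounded it is a
    bounded martingale, hence converges almost surely, and the limit of
    [exp (- h t * Y_t)] is almost surely nonzero because the Laplace transforms
    [E exp (- theta * h t * Y_t)] converge to a limit that tends to 1 as [theta]
    tends to 0.  If [K] tends to infinity, Doob's maximal inequality gives
    [sup_{s >= t} exp (- h s * Y_s) -> 0].  The limit of the Laplace transforms is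
    identified with [h (t + s) / h t -> exp (b * s)], which follows from
    [Psi q / q -> b] at 0. *)

Require Import Defs.
From HB Require Import structures.
From mathcomp Require Import all_boot all_order all_algebra.
From mathcomp Require Import all_classical all_reals all_analysis.
From mathcomp Require Import measurable_realfun ring lra.
Import Order.TTheory GRing.Theory Num.Theory.
Import numFieldNormedType.Exports.
Local Open Scope classical_set_scope.
Local Open Scope ring_scope.

(** * Regularity of the mechanisms *)

(** The flow is known only through its differential equation, so its strict monotonicity, semigroup
    law and inverse all come from Gronwall's inequality, run forwards and backwards in time. This
    asks for [psi] to be Lipschitz down to 0, which the integrability of [min z (z ^ 2)] provides.
    The slope of [phi] at 0 may be infinite, so [phi] is only controlled away from 0.

    No conditional expectation occurs: a martingale is a family whose integrals over every event of
    the past agree. Multiplication by a variable of the past is recovered by step functions. It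
    makes squared increments of a bounded martingale a submartingale, and the maximal inequality
    applied to them gives the Cauchy property. When [K] is unbounded, the maximal inequality is
    applied to the martingale itself: its mean is fixed while [exp (- K)] tends to 0. In both cases
    right continuity of the paths reduces suprema over real times to countably many times. *)

Section mechanisms.
Context {R : realType}.
Implicit Types (p q u L M : R).

Local Notation Rpos := [set u : R | (0 < u)%R].

Lemma measurable_Rpos : measurable Rpos.
Proof.
rewrite (_ : Rpos = `]0, +oo[%classic)//.
by apply/seteqP; split => u /=; rewrite in_itv/= andbT.
Qed.

Lemma measurable_funM_id q : measurable_fun setT (fun u : R => q * u).
Proof. exact: measurable_funM. Qed.

Lemma expRN_ge1B u : 1 - expR (- u) <= u.
Proof. by have := expR_ge1Dx (- u); lra. Qed.

(** Factor out one of the two exponentials and apply [1 + y <= expR y] at [y = (q - p) * u] and at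
    its opposite. *)
Lemma expRN_diff p q u : 0 <= u ->
  (q - p) * u * expR (- (q * u)) <= expR (- (p * u)) - expR (- (q * u)) <=
  (q - p) * u * expR (- (p * u)).
Proof.
move=> u0; apply/andP; split.
  have -> : expR (- (p * u)) = expR (- (q * u)) * expR ((q - p) * u).
    by rewrite -expRD; congr expR; ring.
  have := expR_ge1Dx ((q - p) * u); have := expR_gt0 (- (q * u)); nra.
have -> : expR (- (q * u)) = expR (- (p * u)) * expR (- ((q - p) * u)).
  by rewrite -expRD; congr expR; ring.
have := expR_ge1Dx (- ((q - p) * u)); have := expR_gt0 (- (p * u)); nra.
Qed.

(** The derivative of the kernel in [q] is [u * (1 - expR (- (q * u)))], at most [u] and at most
    [q * u ^+ 2]. Keeping [q] inside the minimum serves twice: bounded by a multiple of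
    [min u (u ^+ 2)] it gives the Lipschitz constant, and as [q] tends to 0 it tends to 0 under a
    fixed dominating function. *)
Lemma branching_kernel_diff p q u : 0 <= u -> 0 <= p -> p <= q ->
  0 <= (expR (- (q * u)) - 1 + q * u) - (expR (- (p * u)) - 1 + p * u) <=
  (q - p) * Num.min u (q * u ^+ 2).
Proof.
move=> u0 p0 pq; have /andP[h1 h2] := expRN_diff p q u u0.
have e1 : expR (- (p * u)) <= 1 by rewrite expR_le1; nra.
have e2 := expRN_ge1B (q * u).
have e3 := expR_gt0 (- (q * u)).
have qp : 0 <= (q - p) * u by apply: mulr_ge0 => //; lra.
apply/andP; split; first by nra.
rewrite minr_pMr; last lra.
rewrite le_min; apply/andP; split; first by nra.
nra.
Qed.

Lemma branching_kernel_le q u : 0 <= u -> 0 <= q ->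
  0 <= expR (- (q * u)) - 1 + q * u <= q * Num.min u (q * u ^+ 2).
Proof.
move=> u0 q0; have := branching_kernel_diff 0 q u u0 (lexx _) q0.
by rewrite !(mul0r, oppr0, expR0, subrr, addr0).
Qed.

Lemma lip_continuous (f : R -> R) a b L x : a < x < b ->
  (forall p q, a <= p -> p <= q -> q <= b -> `|f q - f p| <= L * (q - p)) ->
  {for x, continuous f}.
Proof.
move=> /andP[ax xb] lipf; apply/(@cvgrPdist_le _ R^o) => e e0.
have L0 : 0 <= L.
  have := lipf a b (lexx _) (ltW (lt_trans ax xb)) (lexx _).
  have := normr_ge0 (f b - f a); have : 0 < b - a by lra.
  move=> *; nra.
near=> y.
have ay : a < y by near: y; exact: lt_nbhsr.
have yb : y < b by near: y; exact: lt_nbhsl.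
have dxy : `|x - y| <= e / (L + 1).
  near: y; apply: (@cvgr_dist_le _ R^o _ _ _ id) => //.
  by rewrite divr_gt0 //; lra.
have h : `|f x - f y| <= L * `|x - y|.
  have [xy|yx] := leP x y.
    rewrite distrC (distrC x) (ger0_norm (_ : 0 <= y - x)); last lra.
    by apply: lipf; lra.
  rewrite (ger0_norm (_ : 0 <= x - y)); last lra.
  by apply: lipf; lra.
apply: (le_trans h); move: dxy; rewrite ler_pdivlMr; last lra.
have := normr_ge0 (x - y); nra.
Unshelve. all: by end_near. Qed.

Lemma min_sqr_ge0 q u : 0 < u -> 0 <= q -> 0 <= Num.min u (q * u ^+ 2).
Proof. by move=> u0 q0; rewrite le_min (ltW u0) mulr_ge0// sqr_ge0. Qed.

(** * The branching mechanism: Lipschitz bound and derivative at 0 *)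

Section branching.
Variables (pi : {measure set R -> \bar R}).
Hypothesis pi_int : (\int[pi]_(z in Rpos) (Num.min z (z ^+ 2))%:E < +oo)%E.

Lemma measurable_minM q : measurable_fun setT (fun u : R => Num.min u (q * u ^+ 2)).
Proof.
apply: measurable_minr => //; apply: measurable_funM => //.
Qed.

Lemma integrable_min_sqr q : q <= 1 -> 0 <= q ->
  pi.-integrable Rpos (EFin \o (fun u => Num.min u (q * u ^+ 2))).
Proof.
move=> q1 q0; have mR := measurable_Rpos.
have H : pi.-integrable Rpos (EFin \o (fun u => Num.min u (u ^+ 2))).
  apply/integrableP; split.
    apply/measurable_EFinP; apply: measurable_funTS.
    under eq_fun do rewrite -[_ ^+ 2]mul1r.
    exact: measurable_minM.
  under eq_integral => u /set_mem u0.
    rewrite /= ger0_norm; last by rewrite le_min ltW//= sqr_ge0.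
    over.
  exact: pi_int.
apply: le_integrable H => //.
  by apply/measurable_EFinP; apply: measurable_funTS; exact: measurable_minM.
move=> u /= u0; rewrite lee_fin.
rewrite !ger0_norm ?min_sqr_ge0//; last by rewrite le_min (ltW u0) sqr_ge0.
rewrite le_min !ge_min lexx /=; apply/orP; right.
by have := sqr_ge0 u; nra.
Qed.

Lemma integrable_branching_kernel q : 0 <= q ->
  pi.-integrable Rpos (EFin \o (fun u => expR (- (q * u)) - 1 + q * u)).
Proof.
move=> q0; have mR := measurable_Rpos.
have H := integrableZl mR (q * (q + 1)) (integrable_min_sqr _ (lexx _) ler01).
apply: le_integrable H => //.
  apply/measurable_EFinP; apply: measurable_funTS.
  apply: measurable_funD; last exact: measurable_funM_id.
  apply: measurable_funB => //; apply: measurableT_comp => //.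
  apply: measurableT_comp => //; exact: measurable_funM_id.
move=> u /= u0; rewrite lee_fin.
have /andP[h1 h2] := branching_kernel_le q u (ltW u0) q0.
rewrite !ger0_norm//; last first.
  by rewrite mulr_ge0 ?min_sqr_ge0// mulr_ge0// addr_ge0.
apply: (le_trans h2); rewrite -mulrA ler_wpM2l//.
rewrite minr_pMr; last lra.
rewrite le_min !ge_min mul1r; apply/andP; split; apply/orP; [left|right].
  by nra.
by have := sqr_ge0 u; nra.
Qed.

Let I q := Rintegral pi Rpos (fun u => expR (- (q * u)) - 1 + q * u).

Lemma branching_integral_diff p q : 0 <= p -> p <= q ->
  0 <= I q - I p <= (q - p) * ((q + 1) * Rintegral pi Rpos (fun u => Num.min u (1 * u ^+ 2))).
Proof.
move=> p0 pq; have q0 := le_trans p0 pq; have mR := measurable_Rpos.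
have iq := integrable_branching_kernel q q0.
have ip := integrable_branching_kernel p p0.
have im := integrable_min_sqr _ (lexx _) ler01.
rewrite /I -RintegralB//; apply/andP; split.
  by apply: Rintegral_ge0 => u /= u0; case/andP: (branching_kernel_diff p q u (ltW u0) p0 pq).
rewrite mulrA -RintegralZl//; apply: le_Rintegral => //.
- exact: (integrableB mR iq ip).
- exact: (integrableZl mR _ im).
move=> u /= u0; case/andP: (branching_kernel_diff p q u (ltW u0) p0 pq) => _ h.
apply: (le_trans h); rewrite -mulrA ler_wpM2l//; first lra.
rewrite minr_pMr; last lra.
rewrite le_min !ge_min mul1r; apply/andP; split; apply/orP; [left|right].
  by nra.
by have := sqr_ge0 u; nra.
Qed.

(** The quotient [I q / q] is at most [J q], the integral of [min u (q * u ^+ 2)]. Dominated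
    convergence sends [J] to 0 along [1 / (n + 1)], and monotonicity of [J] extends this to all
    small [q]. *)
Lemma branching_integral_small e : 0 < e ->
  exists2 r, 0 < r & forall q, 0 < q -> q <= r -> 0 <= I q <= e * q.
Proof.
move=> e0; have mR := measurable_Rpos.
pose J q := Rintegral pi Rpos (fun u => Num.min u (q * u ^+ 2)).
have IJ q : 0 < q -> q <= 1 -> 0 <= I q <= q * J q.
  move=> q0 q1; apply/andP; split.
    have := branching_integral_diff 0 q (lexx _) (ltW q0).
    have -> : I 0 = 0.
      rewrite /I; under eq_Rintegral do rewrite mul0r oppr0 expR0 subrr addr0.
      by rewrite /Rintegral integral0_eq.
    by rewrite !subr0 => /andP[].
  rewrite -RintegralZl//; last exact: (integrable_min_sqr _ q1 (ltW q0)).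
  apply: le_Rintegral => //; first exact: (integrable_branching_kernel _ (ltW q0)).
    by exact: (integrableZl mR _ (integrable_min_sqr _ q1 (ltW q0))).
  move=> u /= u0; by have /andP[] := branching_kernel_le q u (ltW u0) (ltW q0).
have Jmono p q : 0 <= p -> p <= q -> q <= 1 -> J p <= J q.
  move=> p0 pq q1; apply: le_Rintegral => //.
  - by apply: integrable_min_sqr => //; lra.
  - by apply: integrable_min_sqr => //; lra.
  move=> u /= u0; rewrite le_min !ge_min lexx/=; apply/orP; right.
  by have := sqr_ge0 u; nra.
have J0 : J n.+1%:R^-1 @[n --> \oo] --> (0 : R^o).
  have n1 n : n.+1%:R^-1 <= 1 :> R by rewrite invf_le1// ler1n.
  have H := @dominated_cvg _ _ _ pi Rpos mR
    (fun n => EFin \o (fun u => Num.min u (n.+1%:R^-1 * u ^+ 2)))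
    (cst 0%E) (EFin \o (fun u => Num.min u (1 * u ^+ 2))).
  have {}H : (\int[pi]_(x in Rpos) (Num.min x (n.+1%:R^-1 * x ^+ 2))%:E)%E @[n --> \oo]
     --> (\int[pi]_(x in Rpos) (cst 0 x))%E.
    apply: H.
    - move=> n; apply/measurable_EFinP; apply: measurable_funTS; exact: measurable_minM.
    - move=> u /= u0; apply: cvg_EFin; first by near=> n.
      apply/(@cvgrPdist_le _ R^o) => d d0.
      near=> n; rewrite sub0r normrN ger0_norm; last first.
        by rewrite min_sqr_ge0.
      rewrite /= ge_min; apply/orP; right.
      rewrite mulrC ler_pdivrMr// mulrC -ler_pdivrMr//.
      apply: (@le_trans _ _ n%:R); last by rewrite ler_nat.
      near: n; exact: nbhs_infty_ger.
    - by [].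
    - exact: (integrable_min_sqr _ (lexx _) ler01).
    - move=> n u /= u0; rewrite lee_fin ger0_norm; last first.
        by rewrite min_sqr_ge0.
      rewrite le_min !ge_min lexx/=; apply/orP; right.
      by rewrite ler_wpM2r ?sqr_ge0.
  rewrite integral0 in H.
  by move/fine_cvgP : H => [].
have /(@cvgrPdist_le _ R^o)/(_ e e0)[n _ Hn] := J0.
have := Hn n (leqnn n); rewrite /= sub0r normrN => Jn.
exists n.+1%:R^-1 => // q q0 qn.
have q1 : q <= 1 by apply: (le_trans qn); rewrite invf_le1// ler1n.
have /andP[-> h] /= := IJ q q0 q1.
apply: (le_trans h); rewrite mulrC ler_wpM2r ?(ltW q0)//.
apply: le_trans Jn; apply: le_trans (ler_norm _).
by apply: Jmono => //; [exact: ltW|rewrite invf_le1// ler1n].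
Unshelve. all: by end_near. Qed.

Lemma Psi_0 sigma b : Psi sigma b pi 0 = 0.
Proof.
rewrite /Psi; under eq_integral do rewrite mul0r oppr0 expR0 subrr addr0.
by rewrite integral0 /= mulr0 expr0n/= mulr0 mul0r !addr0.
Qed.

Lemma Psi_lip sigma b M : exists2 L, 0 <= L &
  forall p q, 0 <= p -> p <= q -> q <= M ->
    `|Psi sigma b pi q - Psi sigma b pi p| <= L * (q - p).
Proof.
set C := Rintegral pi Rpos (fun u => Num.min u (1 * u ^+ 2)).
have C0 : 0 <= C.
  by apply: Rintegral_ge0 => u /= u0; rewrite le_min (ltW u0) mul1r sqr_ge0.
have n1 := normr_ge0 b; have n2 := normr_ge0 M.
exists (`|b| + sigma ^+ 2 * `|M| + (`|M| + 1) * C).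
  by rewrite !addr_ge0// mulr_ge0 ?sqr_ge0// addr_ge0.
move=> p q p0 pq qM; rewrite /Psi -!/(I _).
have /andP[h1 h2] := branching_integral_diff p q p0 pq.
rewrite -!/C in h2.
have MM := ler_norm M.
rewrite (_ : b * q + sigma ^+ 2 * q ^+ 2 / 2 + I q -
             (b * p + sigma ^+ 2 * p ^+ 2 / 2 + I p) =
             b * (q - p) + sigma ^+ 2 * ((q - p) * (q + p) / 2) + (I q - I p)); last first.
  by field.
rewrite [leRHS]mulrDl [X in _ <= X + _]mulrDl; apply: (le_trans (ler_normD _ _)); apply: lerD.
  apply: (le_trans (ler_normD _ _)); apply: lerD.
    by rewrite normrM (ger0_norm (_ : 0 <= q - p))//; lra.
  rewrite normrM (ger0_norm (sqr_ge0 _)) -[leRHS]mulrA ler_wpM2l ?sqr_ge0//.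
  rewrite ger0_norm; first by nra.
  by apply: divr_ge0 => //; apply: mulr_ge0; lra.
rewrite ger0_norm//; apply: (le_trans h2).
rewrite [leRHS]mulrC ler_wpM2l//; first lra.
by rewrite ler_wpM2r//; lra.
Qed.

(** This is the statement that the derivative of [Psi] at 0 is [b]: half of [e] pays for the jump
    integral and half for the quadratic term. *)
Lemma Psi_near0 sigma b e : 0 < e ->
  exists2 r, 0 < r & forall q, 0 < q -> q <= r -> `|Psi sigma b pi q - b * q| <= e * q.
Proof.
move=> e0; have [r r0 Hr] := branching_integral_small (e / 2) (divr_gt0 e0 (ltr0Sn _ _)).
have s0 := sqr_ge0 sigma.
exists (Num.min r (e / (sigma ^+ 2 + 1))); first by rewrite lt_min r0 divr_gt0//; lra.
move=> q q0; rewrite le_min => /andP[qr]; rewrite ler_pdivlMr; last lra.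
move=> qs; have /andP[h1 h2] := Hr q q0 qr.
rewrite /Psi -[fine _]/(I q) -[X in `|X - _|]addrA addrAC subrr add0r ger0_norm.
  have : q * (q * (sigma ^+ 2 + 1)) <= q * e by rewrite ler_wpM2l// ltW.
  have := sqr_ge0 q; lra.
by rewrite addr_ge0// divr_ge0// mulr_ge0 ?sqr_ge0.
Qed.

End branching.

(** * The immigration mechanism: continuity away from 0 *)

Section immigration.
Variables (nu : {measure set R -> \bar R}).
Hypothesis nu_int : (\int[nu]_(z in Rpos) (Num.min 1 z)%:E < +oo)%E.

Lemma integrable_min1 : nu.-integrable Rpos (EFin \o (fun u => Num.min 1 u)).
Proof.
apply/integrableP; split.
  by apply/measurable_EFinP; apply: measurable_funTS; exact: measurable_minr.
under eq_integral => u /set_mem u0.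
  rewrite /= ger0_norm; last by rewrite le_min ler01 ltW.
  over.
exact: nu_int.
Qed.

Lemma integrable_immigration_kernel q : 0 <= q ->
  nu.-integrable Rpos (EFin \o (fun u => 1 - expR (- (q * u)))).
Proof.
move=> q0; have mR := measurable_Rpos.
apply: le_integrable (integrableZl mR (q + 1) integrable_min1) => //.
  apply/measurable_EFinP; apply: measurable_funTS.
  apply: measurable_funB => //; apply: measurableT_comp => //.
  apply: measurableT_comp => //; exact: measurable_funM_id.
move=> u /= u0; rewrite lee_fin.
have h1 : expR (- (q * u)) <= 1 by rewrite expR_le1; nra.
rewrite !ger0_norm; last 2 first.
- by rewrite mulr_ge0//; [lra|rewrite le_min ler01 ltW].
- by lra.
rewrite minr_pMr; last lra.
have := expR_gt0 (- (q * u)); have := expRN_ge1B (q * u).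
by rewrite le_min mulr1 => h2 h3; apply/andP; split; nra.
Qed.

(** The derivative of the kernel, [u * expR (- (p * u))], is at most [u] and, because [p >= a], at
    most [a^-1]; so [(1 + a^-1) * min 1 u] dominates it. *)
Lemma Phi_lip beta a : 0 < a -> exists L, forall p q, a <= p -> p <= q ->
  `|Phi beta nu q - Phi beta nu p| <= L * (q - p).
Proof.
move=> a0; have mR := measurable_Rpos.
pose I q := Rintegral nu Rpos (fun u => 1 - expR (- (q * u))).
pose C := Rintegral nu Rpos (fun u => Num.min 1 u).
exists (`|beta| + (1 + a^-1) * C) => p q ap pq.
have p0 : 0 <= p by lra.
have q0 : 0 <= q by lra.
have iq := integrable_immigration_kernel q q0.
have ip := integrable_immigration_kernel p p0.
rewrite /Phi -/(I q) -/(I p).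
rewrite (_ : beta * q + I q - (beta * p + I p) = beta * (q - p) + (I q - I p)); last by ring.
rewrite mulrDl; apply: (le_trans (ler_normD _ _)); apply: lerD.
  by rewrite normrM (ger0_norm (_ : 0 <= q - p))//; lra.
have E u : 0 < u -> 0 <= (1 - expR (- (q * u))) - (1 - expR (- (p * u))) <=
    (q - p) * (1 + a^-1) * Num.min 1 u.
  move=> u0; have /andP[h1 h2] := expRN_diff p q u (ltW u0).
  have qp : 0 <= (q - p) * u by apply: mulr_ge0; lra.
  have e1 := expR_gt0 (- (q * u)).
  apply/andP; split; first by nra.
  have -> : 1 - expR (- (q * u)) - (1 - expR (- (p * u))) =
    expR (- (p * u)) - expR (- (q * u)) by ring.
  apply: (le_trans h2); rewrite -!mulrA ler_wpM2l//; first lra.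
  have ia : 0 < a^-1 by rewrite invr_gt0.
  have e2 : expR (- (p * u)) <= 1 by rewrite expR_le1; nra.
  rewrite minr_pMr; last lra.
  rewrite le_min mulr1; apply/andP; split; last first.
    by have := expR_gt0 (- (p * u)); nra.
  have : u * expR (- (p * u)) <= a^-1.
    rewrite -ler_pdivlMr ?expR_gt0// -expRN opprK.
    rewrite -(ler_pM2l a0) mulrA divff ?mul1r; last by rewrite gt_eqF.
    apply: (@le_trans _ _ (expR (a * u))); last by rewrite ler_expR; nra.
    by have := expR_ge1Dx (a * u); lra.
  by lra.
have C0 := integrable_min1.
rewrite /I -RintegralB// ger0_norm; last first.
  by apply: Rintegral_ge0 => u /= /E/andP[].
rewrite mulrC mulrA -RintegralZl//; apply: le_Rintegral => //.
- exact: (integrableB mR iq ip).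
- exact: (integrableZl mR _ C0).
by move=> u /= /E/andP[].
Qed.

Lemma Phi_continuous beta q : 0 < q -> {for q, continuous (Phi beta nu)}.
Proof.
move=> q0; have [L lipL] := Phi_lip beta (q / 2) (divr_gt0 q0 (ltr0Sn _ _)).
apply: (@lip_continuous _ (q / 2) (q + 1) L) => //; first lra.
by move=> p q' ? ? ?; exact: lipL.
Qed.

End immigration.
End mechanisms.

(** * Scalar autonomous equations *)

Section ode.
Context {R : realType}.
Implicit Types (f g w dw : R -> R) (a b k T s t p q : R).

Lemma le_of_derive_le0 f (df : R -> R) a b : a <= b ->
  (forall x, a < x < b -> is_derive x 1 f (df x)) ->
  {within `[a, b], continuous f} -> (forall x, a < x < b -> df x <= 0) ->
  f b <= f a.
Proof.
rewrite le_eqVlt => /predU1P[-> //|ab] fd fc df0.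
have fd' x : x \in `]a, b[ -> is_derive x 1 f (df x) by rewrite in_itv/=; exact: fd.
have [c cab e] := MVT ab fd' fc.
move: cab; rewrite in_itv/= => /df0 h.
have : 0 < b - a by lra.
nra.
Qed.

Lemma lt_of_derive_gt0 f (df : R -> R) a b : a < b ->
  (forall x, a < x < b -> is_derive x 1 f (df x)) ->
  {within `[a, b], continuous f} -> (forall x, a < x < b -> 0 < df x) ->
  f a < f b.
Proof.
move=> ab fd fc df0.
have fd' x : x \in `]a, b[ -> is_derive x 1 f (df x) by rewrite in_itv/=; exact: fd.
have [c cab e] := MVT ab fd' fc.
move: cab; rewrite in_itv/= => /df0 h.
have : 0 < b - a by lra.
nra.
Qed.

Lemma is_derive_mull k t : is_derive t 1 (fun t : R => k * t) k.
Proof.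
have h := @is_deriveZ _ _ _ (id : R -> R) k t 1 1.
have := h _; rewrite /GRing.scale/= mulr1; exact.
Qed.

Lemma is_derive_addl s t : is_derive t 1 (fun t : R => s + t) 1.
Proof.
have h := @is_deriveD _ _ _ (cst s : R -> R) id t 1 0 1.
have := h _ _; rewrite add0r; exact.
Qed.

Lemma gronwall w dw k T : 0 <= T -> {within `[0, T], continuous w} ->
  (forall t, 0 < t < T -> is_derive t 1 w (dw t)) ->
  (forall t, 0 < t < T -> dw t <= k * w t) ->
  w T <= w 0 * expR (k * T).
Proof.
move=> T0 wc wd dwk.
have Ed t : is_derive t 1 (expR \o (fun t => - k * t)) (expR (- k * t) * - k).
  apply: is_derive1_comp; exact: is_derive_mull.
have Ec : continuous (expR \o (fun t : R => - k * t)).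
  move=> t; apply: continuous_comp; last exact: continuous_expR.
  exact: mulrl_continuous.
pose F := w * (expR \o (fun t => - k * t)).
have : F T <= F 0.
  apply: (@le_of_derive_le0 F (fun t => (dw t - k * w t) * expR (- k * t))) => //.
  - move=> t /wd wdt; apply: is_derive_eq.
    by rewrite /GRing.scale/=; ring.
  - move=> t; apply: continuousM; first exact: wc.
    exact: continuous_subspaceT.
  - move=> t /dwk h; have := expR_gt0 (- k * t); nra.
rewrite /F /= !fctE mulr0 expR0 mulr1 mulNr expRN.
by rewrite ler_pdivrMr ?expR_gt0.
Qed.

(** The equation is required only for [t > 0], since a two-sided derivative at 0 would depend on
    values of [f] at negative times; continuity ties the solution to its initial value. *)
Definition ode_solution (psi f : R -> R) :=
  [/\ {within `[0, +oo[, continuous f},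
      forall t, 0 < t -> is_derive t 1 f (- psi (f t)) &
      forall t, 0 <= t -> 0 <= f t].

Lemma ode_solution_cont psi f a b : ode_solution psi f -> 0 <= a ->
  {within `[a, b], continuous f}.
Proof.
move=> [fc _ _] a0; apply: continuous_subspaceW fc => x /=.
by rewrite !in_itv/= => /andP[ax _]; rewrite (le_trans a0 ax).
Qed.

Lemma ode_solution_shift psi f s : 0 <= s -> ode_solution psi f ->
  ode_solution psi (fun t => f (s + t)).
Proof.
rewrite le_eqVlt => /predU1P[<-|s0] sf.
  by rewrite (_ : (fun t => f (0 + t)) = f)//; apply/funext => t; rewrite add0r.
have [_ fd f0] := sf.
have D t : 0 <= t -> is_derive t 1 (fun t => f (s + t)) (- psi (f (s + t))).
  move=> t0; have st0 : 0 < s + t by lra.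
  have h := fd _ st0.
  rewrite -[X in is_derive _ _ _ X]mulr1.
  apply: (@is_derive1_comp _ f (fun t => s + t)).
  exact: is_derive_addl.
split.
- apply: derivable_within_continuous => t; rewrite in_itv/= andbT => t0.
  by have [] := D _ t0.
- by move=> t t0; apply: D; exact: ltW.
- by move=> t t0; apply: f0; lra.
Qed.

Lemma ode_solution_bounded psi f T : 0 <= T -> ode_solution psi f ->
  exists M, forall t, 0 <= t <= T -> f t <= M.
Proof.
move=> T0 sf; have [c _ h] := EVT_max T0 (ode_solution_cont _ _ 0 T sf (lexx 0)).
by exists (f c) => t tT; apply: h; rewrite in_itv.
Qed.

Definition locally_lipschitz_pos (psi : R -> R) := forall M, exists2 L, 0 <= L &
  forall p q, 0 <= p -> p <= q -> q <= M -> `|psi q - psi p| <= L * (q - p).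

(** The squared distance is differentiable, unlike the distance, and its derivative is at most
    [2 * L] times itself in absolute value. The upper estimate yields uniqueness and dependence on
    the initial value; the lower one says that distinct solutions never meet. *)
Lemma ode_solution_dist_bounded psi f g T M L : 0 <= T -> 0 <= L ->
  (forall p q, 0 <= p -> p <= q -> q <= M -> `|psi q - psi p| <= L * (q - p)) ->
  ode_solution psi f -> ode_solution psi g ->
  (forall t, 0 <= t <= T -> f t <= M) -> (forall t, 0 <= t <= T -> g t <= M) ->
  (f 0 - g 0) ^+ 2 <= (f T - g T) ^+ 2 * expR (2 * L * T) /\
  (f T - g T) ^+ 2 <= (f 0 - g 0) ^+ 2 * expR (2 * L * T).
Proof.
move=> T0 L0 lipL sf sg fM gM.
have [[_ fd f0] [_ gd g0]] := (sf, sg).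
pose w := (f - g) ^+ 2.
pose dw t := 2 * (f t - g t) * (psi (g t) - psi (f t)).
have wc : {within `[0, T], continuous w}.
  have h : {within `[0, T], continuous (f - g)}.
    by apply: within_continuousB; exact: (ode_solution_cont psi).
  move=> t; rewrite /w (_ : (f - g) ^+ 2 = (f - g) * (f - g)); last first.
    by rewrite expr2.
  by apply: continuousM; exact: h.
have wd t : 0 < t < T -> is_derive t 1 w (dw t).
  move=> /andP[t0 _]; have := fd t t0; have := gd t t0 => ? ?.
  apply: is_derive_eq; rewrite /dw /GRing.scale/= !fctE; ring.
have wE t : w t = (f t - g t) ^+ 2 by rewrite /w !fctE.
have dwk t : 0 < t < T -> `|dw t| <= 2 * L * w t.
  move=> /andP[t0 tT]; have tT' : 0 <= t <= T by rewrite (ltW t0) (ltW tT).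
  have ft := f0 t (ltW t0); have gt := g0 t (ltW t0).
  have fMt := fM t tT'; have gMt := gM t tT'.
  rewrite wE /dw !normrM (ger0_norm (ler0n _ _)) -!mulrA ler_wpM2l//.
  have [fg|gf] := leP (f t) (g t).
    have h := lipL _ _ ft fg gMt.
    rewrite (ler0_norm (_ : f t - g t <= 0)); last lra.
    have : 0 <= g t - f t by lra.
    nra.
  have := lipL _ _ gt (ltW gf) fMt.
  rewrite (ger0_norm (_ : 0 <= f t - g t)); last lra.
  have : 0 < f t - g t by lra.
  rewrite distrC; nra.
split; last first.
  rewrite -!wE; apply: (@gronwall w dw) => // t tT.
  by apply: (le_trans (ler_norm _)); exact: dwk.
(* Gronwall's inequality puts no sign condition on the function or the rate, so it applies to [- w]
   with rate [- (2 * L)]. *)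
have : (- w) T <= (- w) 0 * expR (- (2 * L) * T).
  apply: (@gronwall (- w) (- dw)) => //.
  - move=> t; apply: continuousN; exact: wc.
  - by move=> t /wd h; apply: is_derive_eq.
  - move=> t /dwk; rewrite !fctE mulrNN; apply: le_trans.
    by rewrite -normrN ler_norm.
rewrite !fctE -!wE mulNr lerN2 mulNr expRN ler_pdivrMr ?expR_gt0//.
Qed.

Lemma ode_solution_inj psi f g T : locally_lipschitz_pos psi -> 0 <= T ->
  ode_solution psi f -> ode_solution psi g -> f T = g T -> f 0 = g 0.
Proof.
move=> lip T0 sf sg fgT.
have [M1 fM] := ode_solution_bounded _ _ _ T0 sf.
have [M2 gM] := ode_solution_bounded _ _ _ T0 sg.
have [L L0 lipL] := lip (Num.max M1 M2).
have [||] := @ode_solution_dist_bounded psi f g T _ L T0 L0 lipL sf sg.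
- by move=> t /fM h; rewrite le_max h.
- by move=> t /gM h; rewrite le_max h orbT.
rewrite fgT subrr expr0n mul0r => h _.
by apply/eqP; rewrite -subr_eq0 -sqrf_eq0 eq_le h sqr_ge0.
Qed.

Lemma ode_solution_uniq psi f g T : locally_lipschitz_pos psi -> 0 <= T ->
  ode_solution psi f -> ode_solution psi g -> f 0 = g 0 -> f T = g T.
Proof.
move=> lip T0 sf sg fgT.
have [M1 fM] := ode_solution_bounded _ _ _ T0 sf.
have [M2 gM] := ode_solution_bounded _ _ _ T0 sg.
have [L L0 lipL] := lip (Num.max M1 M2).
have [||] := @ode_solution_dist_bounded psi f g T _ L T0 L0 lipL sf sg.
- by move=> t /fM h; rewrite le_max h.
- by move=> t /gM h; rewrite le_max h orbT.
rewrite fgT subrr expr0n mul0r => _ h.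
by apply/eqP; rewrite -subr_eq0 -sqrf_eq0 eq_le h sqr_ge0.
Qed.

(** If the order were lost by time [T], the two solutions would coincide at some intermediate time,
    and backward uniqueness would make their initial values equal. *)
Lemma ode_solution_lt psi f g T : locally_lipschitz_pos psi -> 0 <= T ->
  ode_solution psi f -> ode_solution psi g -> f 0 < g 0 -> f T < g T.
Proof.
move=> lip T0 sf sg fg0; rewrite ltNge; apply/negP => gfT.
have dc : {within `[0, T], continuous (f - g)}.
  by apply: within_continuousB; exact: (ode_solution_cont psi).
have [|c] := @IVT _ (f - g) 0 T 0 T0 dc.
  rewrite !fctE ge_min le_max; apply/andP; split; apply/orP; [left|right]; lra.
rewrite in_itv/= !fctE => /andP[c0 _] /eqP; rewrite subr_eq0 => /eqP fgc.
have := @ode_solution_inj psi f g c lip c0 sf sg fgc.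
by move=> e; move: fg0; rewrite e ltxx.
Qed.

End ode.

(** * The cumulant flow and its two-sided orbits *)

Section flow.
Context {R : realType}.
Variables (psi : R -> R) (v : R -> R -> R).
Hypothesis psi0 : psi 0 = 0.
Hypothesis psi_lip : locally_lipschitz_pos psi.
Hypothesis v0 : forall p, 0 <= p -> v 0 p = p.
Hypothesis v_sol : forall p, 0 <= p -> ode_solution psi (v^~ p).
Implicit Types (p q s t T : R).

Lemma ode_solution_cst z : 0 <= z -> psi z = 0 -> ode_solution psi (cst z).
Proof.
move=> z0 pz; split => //.
- by apply: continuous_subspaceT => ?; exact: cst_continuous.
- by move=> t _; rewrite /= pz oppr0; exact: is_derive_cst.
Qed.

Lemma flow_ge0 t p : 0 <= t -> 0 <= p -> 0 <= v t p.
Proof. by move=> t0 p0; have [_ _] := v_sol p p0; exact. Qed.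

Lemma flow_fixpoint t z : 0 <= t -> 0 <= z -> psi z = 0 -> v t z = z.
Proof.
move=> t0 z0 pz; apply: (@ode_solution_uniq _ psi (v^~ z) (cst z) t) => //.
- exact: v_sol.
- exact: ode_solution_cst.
- exact: v0.
Qed.

Lemma flow_lt t p q : 0 <= t -> 0 <= p -> p < q -> v t p < v t q.
Proof.
move=> t0 p0 pq; have q0 : 0 <= q by lra.
apply: (@ode_solution_lt _ psi (v^~ p) (v^~ q) t) => //; try exact: v_sol.
by rewrite !v0.
Qed.

Lemma flow_le t p q : 0 <= t -> 0 <= p -> p <= q -> v t p <= v t q.
Proof.
move=> t0 p0; rewrite le_eqVlt => /predU1P[->//|pq].
by rewrite ltW// flow_lt.
Qed.

Lemma flow_inj t p q : 0 <= t -> 0 <= p -> 0 <= q -> v t p = v t q -> p = q.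
Proof.
move=> t0 p0 q0 e; case: (ltgtP p q) => // h.
  by have := flow_lt t p q t0 p0 h; rewrite e ltxx.
by have := flow_lt t q p t0 q0 h; rewrite e ltxx.
Qed.

Lemma flow_gt0 t p : 0 <= t -> 0 < p -> 0 < v t p.
Proof.
move=> t0 p0; rewrite -[X in X < _](flow_fixpoint t 0 t0 (lexx _) psi0).
exact: flow_lt.
Qed.

Lemma flowD s t p : 0 <= s -> 0 <= t -> 0 <= p -> v (s + t) p = v t (v s p).
Proof.
move=> s0 t0 p0.
apply: (@ode_solution_uniq _ psi (fun t => v (s + t) p) (v^~ (v s p)) t) => //.
- exact: (@ode_solution_shift _ psi (v^~ p) s s0 (v_sol _ p0)).
- by apply: v_sol; exact: flow_ge0.
- by rewrite addr0 v0// flow_ge0.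
Qed.

(* For [psi] a branching mechanism this is the open interval from [0] to [rho]. *)
Definition subcritical p := 0 < p /\ forall z, 0 < z <= p -> psi z < 0.

Lemma subcritical_le p q : subcritical q -> 0 < p -> p <= q -> subcritical p.
Proof.
move=> [_ hq] p0 pq; split => // z /andP[z0 zp]; apply: hq.
by rewrite z0 (le_trans zp).
Qed.

Lemma psi_cont z : 0 < z -> {for z, continuous psi}.
Proof.
move=> z0; have [L _ lipL] := psi_lip (z + 1).
by apply: (@lip_continuous _ psi 0 (z + 1) L) => //; lra.
Qed.

Lemma psi_within_cont a b : 0 < a -> {within `[a, b], continuous psi}.
Proof.
move=> a0; apply: continuous_in_subspaceT => z /set_mem/=.
by rewrite in_itv/= => /andP[az _]; apply: psi_cont; lra.
Qed.

(** A zero of [psi] is a fixed point of the flow and hence a barrier. If [psi] became nonnegative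
    below [v t p], it would have a zero [y] with [p < y <= v t p], while monotonicity forces
    [v t p < v t y = y]. *)
Lemma subcritical_flow t p : 0 <= t -> subcritical p -> subcritical (v t p).
Proof.
move=> t0 sp; have [p0 hp] := sp; split; first exact: flow_gt0.
move=> z /andP[z0 zv]; rewrite ltNge; apply/negP => pz0.
have pz : p < z.
  by rewrite ltNge; apply/negP => zp; have := hp z; rewrite z0 zp ltNge pz0 => /(_ isT).
have pp : psi p < 0 by apply: hp; rewrite p0 lexx.
have [|y] := @IVT _ psi p z 0 (ltW pz) (psi_within_cont _ z p0).
  by rewrite ge_min le_max (ltW pp) pz0 orbT.
rewrite in_itv/= => /andP[py yz] py0.
have {}py : p < y.
  by move: py; rewrite le_eqVlt => /predU1P[e|//]; move: pp; rewrite e py0 ltxx.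
have y0 : 0 <= y by lra.
have := flow_lt t p y t0 (ltW p0) py; rewrite (flow_fixpoint t y t0 y0 py0); lra.
Qed.

Lemma subcritical_psi p : subcritical p -> psi p < 0.
Proof. by move=> [p0]; apply; rewrite p0 lexx. Qed.

Lemma subcritical_flow_increasing s t p : 0 <= s -> s < t -> subcritical p ->
  v s p < v t p.
Proof.
move=> s0 st sp; have [p0 _] := sp; have [_ vd _] := v_sol p (ltW p0).
apply: (@lt_of_derive_gt0 _ (v^~ p) (fun t => - psi (v t p))) => //.
- by move=> r /andP[sr _]; apply: vd; lra.
- by apply: (ode_solution_cont psi) => //; apply: v_sol; exact: ltW.
- move=> r /andP[sr _]; rewrite oppr_gt0; apply: subcritical_psi.
  by apply: subcritical_flow => //; lra.
Qed.

Lemma subcritical_flow_ge t p : 0 <= t -> subcritical p -> p <= v t p.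
Proof.
move=> + sp; have [p0 _] := sp; rewrite le_eqVlt => /predU1P[<-|t0].
  by rewrite v0// ltW.
rewrite -{1}(v0 p (ltW p0)); apply/ltW; exact: subcritical_flow_increasing.
Qed.

(** By monotonicity all orbits started below [q] stay under the maximum [M] of the orbit of [q] up
    to time [T], so a single Lipschitz constant of [psi] serves them all. *)
Lemma flow_lip_init T q : 0 <= T -> 0 <= q -> exists2 K, 0 <= K &
  forall p p', 0 <= p -> p <= p' -> p' <= q -> `|v T p' - v T p| <= K * (p' - p).
Proof.
move=> T0 q0; have [M vM] := ode_solution_bounded _ _ _ T0 (v_sol q q0).
have [L L0 lipL] := psi_lip M.
have K0 := expR_gt0 (L * T).
exists (expR (L * T)); first exact: ltW.
move=> p p' p0 pp' pq'.
have vMle r : 0 <= r -> r <= q -> forall t, 0 <= t <= T -> v t r <= M.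
  move=> r0 rq t /[dup] tT /vM; apply: le_trans; apply: flow_le => //.
  by case/andP: tT.
have p0' : 0 <= p' by lra.
have [_] := @ode_solution_dist_bounded _ psi (v^~ p') (v^~ p) T M L T0 L0 lipL
  (v_sol _ p0') (v_sol _ p0) (vMle _ p0' pq') (vMle _ p0 (le_trans pp' pq')).
rewrite !v0// -mulrA (expRM_natl 2) mulrC -exprMn -real_normK ?num_real//.
by rewrite ler_pXn2r ?nnegrE ?mulr_ge0 ?(ltW K0)//; lra.
Qed.

Lemma flow_surj T q y : 0 <= T -> 0 <= q -> 0 <= y <= v T q ->
  exists2 p, 0 <= p <= q & v T p = y.
Proof.
move=> T0 q0 yq; have [K K0 lipK] := flow_lip_init T q T0 q0.
(* The flow is controlled only for initial values in [0, q]; composing with the projection onto this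
   interval gives a function continuous on the whole line, to which the intermediate value theorem
   applies. *)
pose clamp p := Num.min q (Num.max 0 p).
have clamp01 p : 0 <= clamp p <= q by rewrite /clamp le_min q0 le_max lexx ge_min lexx.
have clampE p : 0 <= p <= q -> clamp p = p.
  by move=> /andP[p0 pq]; rewrite /clamp max_r// min_r.
have gc : continuous (v T \o clamp).
  move=> p; apply: (@lip_continuous _ _ (p - 1) (p + 1) K) => /=; first lra.
  move=> a b _ ab _.
  have : 0 <= clamp b - clamp a <= b - a.
    by rewrite /clamp; case: (leP 0 a); case: (leP 0 b) => ? ?; rewrite /Num.min; do ?case: ifP => ?; lra.
  move=> /andP[cab1 cab2].
  have /andP[a0 aq] := clamp01 a; have /andP[b0 bq] := clamp01 b.
  have := lipK _ _ a0 (_ : clamp a <= clamp b) bq.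
  rewrite -subr_ge0 => /(_ cab1) h; nra.
have [|p pq vp] := @IVT _ (v T \o clamp) 0 q y q0 (continuous_subspaceT gc).
  rewrite /= !clampE ?lexx ?q0// flow_fixpoint//.
  rewrite ge_min le_max; case/andP: yq => -> ->; by rewrite orbT.
by exists (clamp p).
Qed.

Section orbit.
Variable lam : R.
Hypothesis lam_sub : subcritical lam.

Let lam0 : 0 < lam. Proof. by case: lam_sub. Qed.

(** Since [lam <= v t lam], surjectivity gives a preimage of [lam] in [0, lam], so [xget] does not
    fall back on its default. The preimage is not 0 because 0 is fixed by the flow. *)
Lemma vinvP t : 0 <= t -> 0 < vinv v t lam <= lam /\ v t (vinv v t lam) = lam.
Proof.
move=> t0; have lv := subcritical_flow_ge t lam t0 lam_sub.
have [|p /andP[p0 pl] vp] := flow_surj t lam lam t0 (ltW lam0).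
  by rewrite lv ltW.
have [h1 h2] : [set mu | 0 <= mu /\ v t mu = lam] (vinv v t lam).
  by apply: (@xgetPex _ 0 [set mu | 0 <= mu /\ v t mu = lam]); exists p.
have e : vinv v t lam = p by apply: (flow_inj t) => //; rewrite h2 vp.
split=> //; rewrite e pl andbT lt_neqAle p0 andbT; apply/eqP => p00.
by move: vp; rewrite -p00 flow_fixpoint// => l0; move: lam0; rewrite -l0 ltxx.
Qed.

Local Notation u := (fun s => vs v s lam).

Lemma orbit_neg t : 0 <= t -> vs v (- t) lam = vinv v t lam.
Proof.
rewrite /vs le_eqVlt => /predU1P[<-|t0].
  rewrite oppr0 lexx v0 ?ltW//.
  have [/andP[h1 _] h2] := vinvP 0 (lexx _).
  by rewrite -{1}h2 v0// ltW.
by rewrite oppr_ge0 leNgt t0/= opprK.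
Qed.

Lemma orbit_sub s : subcritical (u s).
Proof.
have [s0|s0] := leP 0 s; first by rewrite /vs s0; exact: subcritical_flow.
have ns : 0 <= - s by lra.
rewrite -[s]opprK orbit_neg//.
have [/andP[h1 h2] _] := vinvP _ ns.
exact: subcritical_le lam_sub h1 h2.
Qed.

Lemma orbit_gt0 s : 0 < u s.
Proof. by have [] := orbit_sub s. Qed.

(** In the case where [s + t] is still negative, [v (- (s + t))] sends both sides to [lam], and the
    flow is injective. *)
Lemma orbitD s t : 0 <= t -> v t (u s) = u (s + t).
Proof.
move=> t0; have [s0|s0] := leP 0 s.
  by rewrite /vs s0 addr_ge0// -flowD// ltW.
have ns : 0 <= - s by lra.
have [/andP[h1 h2] h3] := vinvP _ ns.
have us : u s = vinv v (- s) lam by rewrite -orbit_neg// opprK.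
rewrite us; have [st|st] := leP 0 (s + t).
  rewrite /vs st -{2}h3 -flowD ?(ltW h1)//; congr (v _ _).
  by rewrite addrA addNr add0r.
have nst : 0 <= - (s + t) by lra.
rewrite -[s + t]opprK orbit_neg//.
have [/andP[k1 k2] k3] := vinvP _ nst.
apply: (flow_inj (- (s + t))) => //; last 1 first.
- rewrite k3 -flowD ?(ltW h1)// -[RHS]h3; congr (v _ _); ring.
- by rewrite flow_ge0// ltW.
- exact: ltW.
Qed.

Lemma orbit_lt s t : s < t -> u s < u t.
Proof.
move=> st; have ts : 0 < t - s by lra.
have -> : t = s + (t - s) by ring.
rewrite -orbitD ?ltW// -{1}(v0 _ (ltW (orbit_gt0 s))).
exact: subcritical_flow_increasing (orbit_sub s).
Qed.

Lemma orbit_le s t : s <= t -> u s <= u t.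
Proof. by rewrite le_eqVlt => /predU1P[->//|/orbit_lt/ltW]. Qed.

(** Restarting the flow from [u (s - 1)] makes [s] the interior time 1 of a forward solution. This
    covers all [s] at once, including 0, where the definition of [vs] changes branch. *)
Lemma is_derive_orbit s : is_derive s 1 u (- psi (u s)).
Proof.
have [_ vd _] := v_sol (u (s - 1)) (ltW (orbit_gt0 _)).
have E r : s - 1 < r -> v (1 - s + r) (u (s - 1)) = u r.
  move=> sr; rewrite orbitD; last lra.
  by congr (vs v _ lam); ring.
apply: (@near_eq_is_derive _ _ _ (fun r => v (1 - s + r) (u (s - 1)))).
  near=> r; apply: E; near: r; apply: lt_nbhsr; lra.
have h := vd 1 ltr01.
rewrite -[X in is_derive _ _ _ X]mulr1.
apply: (@is_derive1_comp _ (v^~ (u (s - 1))) (fun t => 1 - s + t)).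
  have -> : 1 - s + s = 1 by ring.
  by rewrite orbitD// subrK in h *.
exact: is_derive_addl.
Unshelve. all: by end_near. Qed.

Lemma orbit_cont : continuous u.
Proof.
move=> s; apply: differentiable_continuous; apply/derivable1_diffP.
by have [] := is_derive_orbit s.
Qed.

(** Were the orbit to stay above [e], then on [[e, lam]] the function [psi] would have a negative
    maximum [psi c]. The orbit would then lose at least [lam] over a backward time [lam / - psi c],
    contradicting its positivity. *)
Lemma orbit_small e : 0 < e -> exists s, u s < e.
Proof.
move=> e0; apply/not_existsP => H.
have ue s : e <= u s by rewrite leNgt; apply/negP; exact: H.
have el : e <= lam by have := ue 0; rewrite /vs lexx v0// ltW.
have [c cl hc] := EVT_max el (psi_within_cont _ lam e0).
have pc : psi c < 0.
  move: cl; rewrite in_itv/= => /andP[ec cl].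
  by apply: (subcritical_psi c); apply: subcritical_le lam_sub _ cl; lra.
pose N := lam / - psi c.
have N0 : 0 < N by rewrite divr_gt0// oppr_gt0.
have nN0 : - N < 0 by rewrite oppr_lt0.
have [x xN e1] := MVT nN0 (fun x _ => is_derive_orbit x) (continuous_subspaceT orbit_cont).
have u0 : u 0 = lam by rewrite /vs lexx v0// ltW.
have uN := orbit_gt0 (- N).
have : psi (u x) <= psi c.
  apply: hc; rewrite in_itv/= ue/= -[leRHS]u0; apply: orbit_le.
  by move: xN; rewrite in_itv/= => /andP[_ /ltW].
have Ne : N * - psi c = lam by rewrite /N divfK// oppr_eq0 lt_eqF.
rewrite u0 sub0r opprK in e1.
nra.
Qed.

(** * Exponential behaviour of orbits in the distant past *)

Section asymptotics.
Variable b : R.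
Hypothesis b0 : b < 0.
Hypothesis psi_near0 : forall e, 0 < e ->
  exists2 r, 0 < r & forall q, 0 < q -> q <= r -> `|psi q - b * q| <= e * q.

(** The derivative of [ln u] is [- psi u / u], within [e] of [- b] once the orbit is small. The
    bound is uniform in [s] and [c], so that one threshold [S] handles shifts in both directions. *)
Lemma orbit_log_ratio e : 0 < e -> exists S, forall s c, s <= S -> s + c <= S ->
  `|ln (u (s + c)) - ln (u s) + b * c| <= e * `|c|.
Proof.
move=> e0; have [r r0 psir] := psi_near0 e e0.
have [S uS] := orbit_small r r0; exists S.
have main s c : 0 < c -> s + c <= S -> `|ln (u (s + c)) - ln (u s) + b * c| <= e * c.
  move=> c0 scS.
  have D t : is_derive t 1 (@ln R \o u) ((u t)^-1 * - psi (u t)).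
    apply: is_derive1_comp; first exact: is_derive1_ln (orbit_gt0 t).
    exact: is_derive_orbit.
  have C : continuous (@ln R \o u).
    move=> t; apply: differentiable_continuous; apply/derivable1_diffP.
    by have [] := D t.
  have ssc : s < s + c by lra.
  have [x xc /= ->] := MVT ssc (fun x _ => D x) (continuous_subspaceT C).
  move: xc; rewrite in_itv/= => /andP[sx xsc].
  have ux := orbit_gt0 x.
  have xS : x <= S by lra.
  have uxr : u x <= r := le_trans (orbit_le x S xS) (ltW uS).
  have := psir _ ux uxr.
  rewrite (_ : _ + b * c = - (psi (u x) - b * u x) * (u x)^-1 * c); last first.
    by field; rewrite gt_eqF.
  move=> h; rewrite normrM (gtr0_norm c0) ler_wpM2r ?(ltW c0)//.
  by rewrite normrM normrN normfV (gtr0_norm ux) ler_pdivrMr.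
move=> s c sS scS; have [c0|c0|<-] := ltgtP 0 c.
- by rewrite (gtr0_norm c0); exact: main.
- have := main (s + c) (- c); rewrite addrK oppr_gt0 => /(_ c0 sS).
  rewrite (ltr0_norm c0) -normrN; congr (`|_| <= _); ring.
- by rewrite addr0 subrr mulr0 addr0 normr0 mulr0.
Qed.

(** With [a = - (ln theta / b)], scaling by [theta] is asymptotically a time shift by [a]. So
    [theta * u (- t)] lies between [u (- t + (a - d))] and [u (- t + (a + d))] for large [t], and
    applying [v t] moves these bounds to [u (a - d)] and [u (a + d)]. *)
Lemma cvg_orbit_scaled theta : 0 < theta ->
  v t (theta * vinv v t lam) @[t --> +oo] --> vs v (- (ln theta / b)) lam.
Proof.
move=> th0; set a := - (ln theta / b).
have ab : ln theta = - (b * a) by rewrite /a; field; rewrite lt_eqF.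
apply/(@cvgrPdist_le _ R^o) => e e0.
have [d d0 ud] : exists2 d, 0 < d & forall x, `|a - x| <= d -> `|u a - u x| <= e.
  have /(@cvgrPdist_le _ R^o)/(_ e e0)/nbhs_ballP[d /= d0 ud] := orbit_cont a.
  exists (d / 2); first exact: divr_gt0.
  by move=> x ax; apply: ud; apply: (le_lt_trans ax); lra.
pose e' := - b * d / (`|a| + d + 1).
have na := normr_ge0 a.
have e'0 : 0 < e'.
  rewrite divr_gt0 ?mulr_gt0 ?oppr_gt0//.
  lra.
have [S ratio] := orbit_log_ratio e' e'0.
have e'E : e' * (`|a| + d + 1) = - b * d.
  by rewrite /e' divfK// gt_eqF//; lra.
near=> t.
have t0 : 0 <= t by near: t; exact: nbhs_pinfty_ge.
have tS : - t <= S by rewrite lerNl; near: t; apply: nbhs_pinfty_ge; exact: num_real.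
have tadS : - t + (a + d) <= S.
  suff : a + d - S <= t by lra.
  by near: t; apply: nbhs_pinfty_ge; exact: num_real.
have ut : vinv v t lam = u (- t) by rewrite /= orbit_neg.
have ut0 := orbit_gt0 (- t).
have hi : theta * u (- t) <= u (- t + (a + d)).
  rewrite -ler_ln ?posrE ?mulr_gt0 ?orbit_gt0// lnM ?posrE//.
  have := ratio (- t) (a + d) tS tadS; rewrite ler_norml => /andP[+ _].
  have : e' * `|a + d| <= e' * (`|a| + d + 1).
    rewrite ler_wpM2l ?(ltW e'0)//; have := ler_normD a d; rewrite (gtr0_norm d0); lra.
  rewrite e'E ab; lra.
have lo : u (- t + (a - d)) <= theta * u (- t).
  rewrite -ler_ln ?posrE ?mulr_gt0 ?orbit_gt0// lnM ?posrE//.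
  have h : - t + (a - d) <= S by lra.
  have := ratio (- t) (a - d) tS h; rewrite ler_norml => /andP[_].
  have : e' * `|a - d| <= e' * (`|a| + d + 1).
    rewrite ler_wpM2l ?(ltW e'0)//; have := ler_normB a d; rewrite (gtr0_norm d0); lra.
  rewrite e'E ab; lra.
rewrite ut.
have h1 : v t (theta * u (- t)) <= u (a + d).
  have -> : a + d = - t + (a + d) + t by ring.
  rewrite -orbitD//; apply: flow_le => //; rewrite mulr_ge0// ltW//.
have h2 : u (a - d) <= v t (theta * u (- t)).
  have -> : a - d = - t + (a - d) + t by ring.
  by rewrite -orbitD//; apply: flow_le => //; rewrite ltW// orbit_gt0.
have : `|u a - u (a + d)| <= e.
  by apply: ud; rewrite opprD addNKr normrN gtr0_norm.
have : `|u a - u (a - d)| <= e.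
  by apply: ud; rewrite opprB addrC subrK gtr0_norm.
rewrite !ler_norml => /andP[_ k1] /andP[k2 _].
by apply/andP; split; lra.
Unshelve. all: by end_near. Qed.

End asymptotics.
End orbit.
End flow.

(** * Integrals along orbits *)

Section occupation.
Context {R : realType}.
Variables (phi psi : R -> R) (v : R -> R -> R).
Hypothesis phi_cont : forall q, 0 < q -> {for q, continuous phi}.
Hypothesis phi_gt0 : forall q, 0 < q -> 0 < phi q.
Hypothesis psi0 : psi 0 = 0.
Hypothesis psi_lip : locally_lipschitz_pos psi.
Hypothesis v0 : forall p, 0 <= p -> v 0 p = p.
Hypothesis v_sol : forall p, 0 <= p -> ode_solution psi (v^~ p).
Implicit Types (p q s t x y z : R).

Local Notation leb := (@lebesgue_measure R).
Local Notation F := (fun u : R => phi u / `|psi u|).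
Local Notation G y z := (Rintegral leb `[y, z] F).

Lemma ratio_ge0 x : 0 < x -> 0 <= F x.
Proof. by move=> /phi_gt0/ltW h; rewrite divr_ge0. Qed.

Lemma ratio_continuous z : subcritical psi z -> {for z, continuous F}.
Proof.
move=> sz; have [z0 _] := sz; have pz := subcritical_psi psi z sz.
apply: cvgM; first exact: phi_cont.
apply: cvgV; first by rewrite normr_eq0 lt_eqF.
apply: cvg_norm; exact: psi_cont.
Qed.

Lemma ratio_within_continuous y z : 0 < y -> subcritical psi z ->
  {within `[y, z], continuous F}.
Proof.
move=> y0 sz; apply: continuous_in_subspaceT => x /set_mem/=.
rewrite in_itv/= => /andP[yx xz]; apply: ratio_continuous.
by apply: subcritical_le sz _ xz; lra.
Qed.

Lemma ratio_integrable y z : 0 < y -> subcritical psi z ->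
  leb.-integrable `[y, z] (EFin \o F).
Proof.
move=> y0 sz; apply: continuous_compact_integrable; first exact: segment_compact.
exact: ratio_within_continuous.
Qed.

Lemma ratio_measurable z : measurable_fun `]0, z] F.
Proof.
have C (f : R -> R) : (forall q, 0 < q -> {for q, continuous f}) ->
    measurable_fun `]0, z] f.
  move=> fc; apply: subspace_continuous_measurable_fun => //.
  apply: continuous_in_subspaceT => x /set_mem/=.
  by rewrite in_itv/= => /andP[x0 _]; exact: fc.
apply: measurable_funM; first exact: C.
rewrite (_ : (fun x => `|psi x|^-1) = (fun x => `|psi x| `^ (-1))); last first.
  by apply/funext => x; rewrite powR_inv1.
apply: (@measurableT_comp _ _ _ _ _ _ (@powR R ^~ (-1)) _ (fun x => `|psi x|)).
  exact: measurable_powR.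
by apply: measurableT_comp => //; apply: C; exact: psi_cont.
Qed.

Lemma Rintegral_chasles (f : R -> R) x y z : x <= y -> y <= z ->
  leb.-integrable `[x, z] (EFin \o f) ->
  Rintegral leb `[x, z] f = Rintegral leb `[x, y] f + Rintegral leb `[y, z] f.
Proof.
move=> xy yz fi.
have := @Rintegral_itvB _ f (BLeft x) (BRight z) y fi; rewrite !bnd_simp.
move=> /(_ xy yz) h; rewrite -(Rintegral_itv_obnd_cbnd (r := y)).
  by rewrite -h addrC subrK.
by apply: integrableS fi => //; apply: subset_itvr; rewrite bnd_simp.
Qed.

(** Substitute [y = v r p], for which [dy = |psi y| dr]. The two-sided orbit is continuously
    differentiable on the whole line, which settles the conditions at both endpoints. *)
Lemma flow_integral t p : 0 <= t -> subcritical psi p ->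
  Rintegral leb `[0, t] (fun r => phi (v r p)) = G p (v t p).
Proof.
move=> t0 sp; have [p0 _] := sp.
pose u s := vs v s p.
have uE s : 0 <= s -> u s = v s p by move=> s0; rewrite /u /vs s0.
have Du s : is_derive s 1 u (- psi (u s)) by exact: is_derive_orbit.
have u' : (derive1 u) = (fun s => - psi (u s)).
  apply/funext => s; rewrite derive1E.
  exact: (@derive_val _ _ _ _ _ _ _ (Du s)).
have uc : continuous u by exact: (orbit_cont psi v psi0 psi_lip v0 v_sol p sp).
have u'c : continuous (derive1 u).
  rewrite u' => s; apply: cvgN; apply: continuous_comp; first exact: uc.
  by apply: (psi_cont psi psi_lip); exact: (orbit_gt0 psi v psi0 psi_lip v0 v_sol p sp).
have su s : subcritical psi (u s) by exact: (orbit_sub psi v psi0 psi_lip v0 v_sol p sp).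
have := @integration_by_substitution_increasing R u F 0 t t0.
rewrite !uE// v0 ?(ltW p0)// => subst; rewrite /Rintegral subst.
- congr fine; apply: eq_integral => r /set_mem/=.
  rewrite in_itv/= => /andP[r0 _]; congr EFin.
  have h := subcritical_psi psi (u r) (su r).
  rewrite !fctE /= u' -uE// ltr0_norm//; field.
  by rewrite lt_eqF.
- by move=> r s _ _; exact: (orbit_lt psi v psi0 psi_lip v0 v_sol p sp).
- by move=> r _; exact: u'c.
- by apply: (cvgP ((derive1 u) 0)); apply: cvg_at_right_filter; exact: u'c.
- by apply: (cvgP ((derive1 u) t)); apply: cvg_at_left_filter; exact: u'c.
- split.
  + by move=> r _; have [] := Du r.
  + by apply: cvg_at_right_filter; exact: uc.
  + by apply: cvg_at_left_filter; exact: uc.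
- rewrite -uE//; exact: ratio_within_continuous.
Qed.

Section exponent.
Variable lam : R.
Hypothesis lam_sub : subcritical psi lam.

Let lam0 : 0 < lam. Proof. by case: lam_sub. Qed.

Definition immigration_exponent t := G (vinv v t lam) lam.
Local Notation K := immigration_exponent.

Let vinvP := vinvP psi v psi0 psi_lip v0 v_sol lam lam_sub.
Let orbit_neg := orbit_neg psi v psi0 psi_lip v0 v_sol lam lam_sub.
Let orbitD := orbitD psi v psi0 psi_lip v0 v_sol lam lam_sub.
Let orbit_le := orbit_le psi v psi0 psi_lip v0 v_sol lam lam_sub.
Let orbit_small := orbit_small psi v psi0 psi_lip v0 v_sol lam lam_sub.

Lemma vinv_sub t : 0 <= t -> subcritical psi (vinv v t lam).
Proof.
by move=> t0; have [/andP[h1 h2] _] := vinvP _ t0; exact: subcritical_le lam_sub h1 h2.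
Qed.

Lemma flow_vinv s t : 0 <= s -> 0 <= t -> v t (vinv v (s + t) lam) = vinv v s lam.
Proof.
move=> s0 t0; have st0 := addr_ge0 s0 t0.
rewrite -!orbit_neg// orbitD//.
by congr (vs v _ lam); ring.
Qed.

(** The flow carries [vinv v (s + t) lam] to [vinv v s lam] in time [t], so the time integral is the
    part of [K (s + t)] between these two points. It is the exponent in the transition formula from
    [s] to [s + t]. *)
Lemma flow_integral_vinv s t : 0 <= s -> 0 <= t ->
  Rintegral leb `[0, t] (fun r => phi (v r (vinv v (s + t) lam))) = K (s + t) - K s.
Proof.
move=> s0 t0; have st0 := addr_ge0 s0 t0.
rewrite flow_integral//; last exact: vinv_sub.
rewrite flow_vinv// /K (@Rintegral_chasles _ (vinv v (s + t) lam) (vinv v s lam) lam).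
- by rewrite addrK.
- by rewrite -(flow_vinv s t)//; apply: (@subcritical_flow_ge _ psi) => //; exact: vinv_sub.
- by have [/andP[]] := vinvP _ s0.
- by apply: ratio_integrable => //; have [/andP[]] := vinvP _ st0.
Qed.

Lemma immigration_exponent_le s t : 0 <= s -> s <= t -> K s <= K t.
Proof.
move=> s0 st; rewrite -subr_ge0.
have ts0 : 0 <= t - s by lra.
have -> : t = s + (t - s) by ring.
rewrite -flow_integral_vinv//; apply: Rintegral_ge0 => r /=.
rewrite in_itv/= => /andP[r0 _]; apply/ltW/phi_gt0.
apply: (@flow_gt0 _ psi) => //.
by have [/andP[]] := vinvP _ (addr_ge0 s0 ts0).
Qed.

(** The intervals from [vinv v n lam] to [lam] increase to []0, lam]] because the orbit becomes
    arbitrarily small. Monotone convergence treats integer times, and monotonicity of [K] the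
    others. *)
Lemma immigration_exponent_infty :
  (\int[leb]_(u in `]0%R, lam]) (F u)%:E = +oo)%E ->
  forall C, exists2 T, 0 <= T & forall t, T <= t -> C <= K t.
Proof.
move=> Foo C.
pose A (n : nat) := `[vinv v n%:R lam, lam]%classic.
have mA n : measurable (A n) by exact: measurable_itv.
have hpos n : 0 < vinv v n%:R lam by have [/andP[]] := vinvP _ (ler0n R n).
have A0 n : A n `<=` `]0, lam]%classic.
  move=> x; rewrite /A /= !in_itv/= => /andP[h ->]; rewrite andbT.
  by have := hpos n; lra.
have hle m n : (m <= n)%N -> vinv v n%:R lam <= vinv v m%:R lam.
  move=> mn; rewrite -!orbit_neg//; apply: orbit_le => //.
  by rewrite lerN2 ler_nat.
have UA : \bigcup_n A n = `]0, lam]%classic.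
  apply/seteqP; split => [x [n _ /A0//]|x /=].
  rewrite in_itv/= => /andP[x0 xl].
  have [s us] := orbit_small x x0.
  have [n sn] : exists n : nat, - s <= n%:R.
    by have [n _ Hn] := nbhs_infty_ger (- s); exists n; apply: (Hn n) => /=.
  exists n => //; rewrite /A/= in_itv/= xl andbT.
  rewrite -orbit_neg//; apply: (le_trans _ (ltW us)).
  by apply: orbit_le; lra.
have Fm : measurable_fun (`]0, lam]%classic : set R) (EFin \o F).
  by apply/measurable_EFinP; exact: ratio_measurable.
have cvA : (\int[leb]_(x in A n) (F x)%:E)%E @[n --> \oo] --> +oo%E.
  rewrite -Foo -UA; apply: ge0_nondecreasing_set_cvg_integral => //.
  - apply/nondecreasing_seqP => n; rewrite subsetEset; apply: subset_itvr.
    by rewrite bnd_simp hle.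
  - by move=> n; exact: measurable_funS (A0 n) Fm.
  - by move=> n x /A0 /=; rewrite in_itv/= lee_fin => /andP[x0 _]; exact: ratio_ge0.
have /cvgeyPge/(_ C)[n _ Hn] := cvA.
exists n%:R => // t nt; apply: (@le_trans _ _ (K n%:R)); last first.
  exact: immigration_exponent_le.
have /integrable_fin_num fin := ratio_integrable _ _ (hpos n) lam_sub.
by rewrite -lee_fin /K /Rintegral fineK ?fin//; exact: (Hn n (leqnn n)).
Qed.

Section integrable.
Hypothesis F_int : exists e, 0 < e /\ (\int[leb]_(u in `]0%R, e]) (F u)%:E < +oo)%E.

Lemma ratio_integrable0 z : subcritical psi z -> leb.-integrable `[0, z] (EFin \o F).
Proof.
move=> sz; have [e [e0 Fe]] := F_int; have [z0 _] := sz.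
have mF := ratio_measurable z.
have FE y : (\int[leb]_(x in `]0%R, y]) `|(F x)%:E| = \int[leb]_(x in `]0%R, y]) (F x)%:E)%E.
  apply: eq_integral => x /set_mem/=.
  by rewrite in_itv/= => /andP[x0 _]; rewrite ger0_norm// ratio_ge0.
apply/integrableP; split.
  apply/measurable_EFinP/measurable_fun_itv_obnd_cbndP; exact: mF.
rewrite -integral_itv_obnd_cbnd; last first.
  by apply: measurableT_comp => //; apply/measurable_EFinP.
have H y : leb.-integrable `]0, y] (EFin \o F) <-> (\int[leb]_(x in `]0%R, y]) (F x)%:E < +oo)%E.
  rewrite -FE; split; first by case/integrableP.
  move=> h; apply/integrableP; split => //.
  by apply/measurable_EFinP; exact: ratio_measurable.
have {}Fe : leb.-integrable `]0, e] (EFin \o F) by exact/H.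
rewrite /= FE; apply/H.
have [ze|ez] := leP z e.
  by apply: integrableS Fe => //; apply: subset_itvl; rewrite bnd_simp.
have Fez : leb.-integrable `]e, z] (EFin \o F).
  apply: integrableS (ratio_integrable _ _ e0 sz) => //.
  by apply: subset_itvr; rewrite bnd_simp.
rewrite (@itv_bndbnd_setU _ _ _ (BRight e)) ?bnd_simp ?(ltW ez) ?(ltW e0)//.
apply/integrableP; split.
  apply/measurable_EFinP; rewrite -itv_bndbnd_setU ?bnd_simp ?(ltW ez) ?(ltW e0)//.
rewrite ge0_integral_setU//=.
- apply: lte_add_pinfty; first by case/integrableP : Fe.
  by case/integrableP : Fez.
- rewrite -itv_bndbnd_setU ?bnd_simp ?(ltW ez) ?(ltW e0)//.
  by apply/measurable_EFinP; apply: measurableT_comp.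
- apply/disj_setPS => y [/=]; rewrite 2!in_itv/= => /andP[_ yx] /andP[].
  by rewrite ltNge yx.
Qed.

(** On [[z / 2, z]] the integrand is continuous with a positive minimum. The strict inequality is
    what makes the Laplace transform of the limit smaller than 1. *)
Lemma ratio_integral_gt0 z : subcritical psi z -> 0 < G 0 z.
Proof.
move=> sz; have [z0 _] := sz; have z20 : 0 < z / 2 by rewrite divr_gt0.
have z2z : z / 2 <= z by lra.
rewrite (@Rintegral_chasles _ 0 (z / 2) z (ltW z20) z2z (ratio_integrable0 z sz)).
have G1 : 0 <= G 0 (z / 2).
  apply: Rintegral_ge0 => x /=; rewrite in_itv/= => /andP[+ xz].
  rewrite le_eqVlt => /predU1P[<-|x0]; last exact: ratio_ge0.
  (* At 0 the integrand is 0 by the convention [0^-1 = 0]. *)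
  by rewrite psi0 normr0 invr0 mulr0.
have cF := ratio_within_continuous _ _ z20 sz.
have [c cz hc] := EVT_min z2z cF.
have c0 : 0 < F c.
  move: cz; rewrite in_itv/= => /andP[cz1 cz2].
  have c0 : 0 < c by lra.
  rewrite divr_gt0 ?phi_gt0// normr_gt0 lt_eqF// subcritical_psi//.
  exact: subcritical_le sz c0 cz2.
have G2 : F c * (z - z / 2) <= G (z / 2) z.
  have -> : F c * (z - z / 2) = Rintegral leb `[z / 2, z] (cst (F c)).
    rewrite Rintegral_cst//; congr (_ * _).
    rewrite /= lebesgue_measure_itv/= lte_fin ifT//; lra.
  apply: le_Rintegral => //.
  - apply: continuous_compact_integrable; first exact: segment_compact.
    by apply: continuous_subspaceT => ?; exact: cst_continuous.
  - exact: ratio_integrable.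
apply: (lt_le_trans _ (lerD G1 G2)); rewrite add0r.
by apply: mulr_gt0 => //; lra.
Qed.

Lemma ratio_integral_continuous z : subcritical psi z ->
  {within `[0, z], continuous (fun y => G 0 y)}.
Proof.
move=> sz; have [z0 _] := sz.
by apply: parameterized_integral_continuous (ltW z0) (ratio_integrable0 z sz).
Qed.

Lemma cvg_ratio_integral0 : G 0 y @[y --> 0] --> 0.
Proof.
by apply: parameterized_integral_cvg_left lam0 (ratio_integrable0 _ lam_sub).
Qed.

Lemma immigration_exponentE t : 0 <= t -> K t = G 0 lam - G 0 (vinv v t lam).
Proof.
move=> t0; have [/andP[h0 h1] _] := vinvP _ t0.
rewrite (@Rintegral_chasles _ 0 _ lam (ltW h0) h1 (ratio_integrable0 _ lam_sub)).
by rewrite addrC addKr.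
Qed.

Lemma cvg_vinv0 : vinv v t lam @[t --> +oo] --> 0.
Proof.
apply/(@cvgrPdist_le _ R^o) => e e0.
have [s us] := orbit_small _ e0.
near=> t.
have t0 : 0 <= t by near: t; exact: nbhs_pinfty_ge.
have [/andP[h0 h1] _] := vinvP _ t0.
rewrite sub0r normrN gtr0_norm// -orbit_neg// (le_trans _ (ltW us))// orbit_le//.
by rewrite lerNl; near: t; apply: nbhs_pinfty_ge; exact: num_real.
Unshelve. all: by end_near. Qed.

Section limit.
Variable b : R.
Hypothesis b0 : b < 0.
Hypothesis psi_near0 : forall e, 0 < e ->
  exists2 r, 0 < r & forall q, 0 < q -> q <= r -> `|psi q - b * q| <= e * q.

Lemma cvg_flow_integral theta : 0 < theta ->
  Rintegral leb `[0, t] (fun r => phi (v r (theta * vinv v t lam))) @[t --> +oo]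
    --> G 0 (vs v (- (ln theta / b)) lam).
Proof.
move=> th0; set a := - (ln theta / b); set V := vs v a lam.
have cV := cvg_orbit_scaled psi v psi0 psi_lip v0 v_sol lam lam_sub b b0 psi_near0 theta th0.
rewrite -/a -/V in cV.
(* A later point of the orbit lies strictly above [V] and is still subcritical: [V] becomes interior
   to an interval on which the integral is continuous, and [v t (theta * vinv v t lam)] is
   eventually subcritical. *)
have sV1 : subcritical psi (vs v (a + 1) lam) by exact: (orbit_sub psi v).
have VV1 : V < vs v (a + 1) lam by apply: (orbit_lt psi v) => //; lra.
have V0 : 0 < V by exact: (orbit_gt0 psi v).
have [V1 _] := sV1.
have cG : {for V, continuous (fun y => G 0 y)}.
  apply: (within_continuous_continuous V1 (ratio_integral_continuous _ sV1)).
  by rewrite in_itv/= V0.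
have cth : theta * vinv v t lam @[t --> +oo] --> 0.
  rewrite -[0](mulr0 theta); apply: cvgM; first exact: cvg_cst.
  exact: cvg_vinv0.
have h1 : G 0 (v t (theta * vinv v t lam)) @[t --> +oo] --> G 0 V.
  exact: (cvg_comp _ _ cV cG).
have h2 : G 0 (theta * vinv v t lam) @[t --> +oo] --> 0.
  exact: (cvg_comp _ _ cth cvg_ratio_integral0).
have h3 : G 0 (v t (theta * vinv v t lam)) - G 0 (theta * vinv v t lam)
    @[t --> +oo] --> G 0 V.
  by rewrite -[G 0 V]subr0; apply: cvgB.
apply: cvg_trans h3; apply: near_eq_cvg; near=> t.
have t0 : 0 <= t by near: t; exact: nbhs_pinfty_ge.
have [/andP[k0 k1] _] := vinvP _ t0.
have p0 : 0 < theta * vinv v t lam by rewrite mulr_gt0.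
have vV1 : v t (theta * vinv v t lam) <= vs v (a + 1) lam.
  near: t; move/(@cvgrPdist_le _ R^o) : cV => /(_ (vs v (a + 1) lam - V)).
  rewrite subr_gt0 => /(_ VV1); apply: filterS => t.
  rewrite ler_norml => /andP[]; lra.
have sv : subcritical psi (v t (theta * vinv v t lam)).
  by apply: subcritical_le sV1 _ vV1; apply: (flow_gt0 psi).
have sp : subcritical psi (theta * vinv v t lam).
  apply: subcritical_le lam_sub p0 _.
  near: t; move/(@cvgrPdist_le _ R^o) : cth => /(_ lam lam0); apply: filterS => t.
  by rewrite sub0r normrN; apply: le_trans; exact: ler_norm.
rewrite flow_integral//; have pv := subcritical_flow_ge psi v psi0 psi_lip v0 v_sol _ _ t0 sp.
rewrite (@Rintegral_chasles _ 0 _ _ (ltW p0) pv (ratio_integrable0 _ sv)).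
by rewrite [LHS]addrC addKr.
Unshelve. all: by end_near. Qed.

(* [theta] is taken small so that [vs v (- (ln theta / b)) lam] is close to 0. *)
Lemma small_exponent x e : 0 <= x -> 0 < e -> exists2 theta, 0 < theta &
  let V := vs v (- (ln theta / b)) lam in x * V + G 0 V <= e.
Proof.
move=> x0 e0; have e2 : 0 < e / 2 by rewrite divr_gt0.
have /(@cvgrPdist_le _ R^o)/(_ _ e2)/nbhs_ballP[d /= d0 H] := cvg_ratio_integral0.
have m0 : 0 < Num.min d (e / 2 / (x + 1)).
  by rewrite lt_min d0 divr_gt0//; lra.
have [s us] := orbit_small _ m0.
exists (expR (- (b * s))); first exact: expR_gt0.
rewrite expRK /= (_ : - (- (b * s) / b) = s); last by field; rewrite lt_eqF.
have u0 : 0 < vs v s lam by exact: (orbit_gt0 psi v).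
move: us; rewrite lt_min => /andP[ud]; rewrite ltr_pdivlMr; last lra.
move=> ux.
have : `|0 - G 0 (vs v s lam)| <= e / 2.
  by apply: H; rewrite /ball/= sub0r normrN gtr0_norm.
rewrite sub0r normrN => /(le_trans (ler_norm _)) h.
have : 0 <= x * vs v s lam by rewrite mulr_ge0// ltW.
lra.
Qed.
End limit.
End integrable.
End exponent.
End occupation.

(** * Bounded integrands and events of the past *)

Section bounded_integrals.
Context d (Omega : measurableType d) (R : realType) (P : probability Omega R).
Implicit Types (A B : set Omega) (f g : Omega -> R).

Lemma bounded_integrable C f A : measurable_fun setT f ->
  (forall w, `|f w| <= C) -> measurable A -> P.-integrable A (EFin \o f).
Proof.
move=> mf fC mA; apply: measurable_bounded_integrable => //.
- by rewrite (le_lt_trans (probability_le1 P mA))// ltry.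
- exact: measurable_funTS.
- exists C; split; first exact: num_real.
  by move=> M CM w _; exact: le_trans (fC w) (ltW CM).
Qed.

Lemma le_Rintegral_bounded C f g A : measurable_fun setT f -> measurable_fun setT g ->
  (forall w, `|f w| <= C) -> (forall w, `|g w| <= C) -> measurable A ->
  (forall w, A w -> f w <= g w) -> Rintegral P A f <= Rintegral P A g.
Proof.
move=> mf mg fC gC mA fg.
by apply: le_Rintegral => //; exact: (bounded_integrable C).
Qed.

Lemma Rintegral_sqrB C f g A : measurable_fun setT f -> measurable_fun setT g ->
  (forall w, `|f w| <= C) -> (forall w, `|g w| <= C) -> measurable A ->
  Rintegral P A (fun w => (f w - g w) ^+ 2) =
  Rintegral P A (fun w => f w ^+ 2) - 2 * Rintegral P A (fun w => f w * g w) +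
  Rintegral P A (fun w => g w ^+ 2).
Proof.
move=> mf mg fC gC mA.
have C0 : 0 <= C by apply: le_trans (fC point).
have bM (f' g' : Omega -> R) : measurable_fun setT f' -> measurable_fun setT g' ->
    (forall w, `|f' w| <= C) -> (forall w, `|g' w| <= C) ->
    P.-integrable A (EFin \o (fun w => f' w * g' w)).
  move=> mf' mg' fC' gC'; apply: (bounded_integrable (C * C)) => //.
    exact: measurable_funM.
  by move=> w; rewrite normrM ler_pM.
have i1 := bM f f mf mf fC fC; have i2 := bM f g mf mg fC gC; have i3 := bM g g mg mg gC gC.
have i4 := integrableZl mA 2 i2.
rewrite -RintegralZl//.
have i5 := integrableB mA i1 i4.
rewrite (_ : (fun w => f w ^+ 2) = (fun w => f w * f w)) //.
rewrite (_ : (fun w => g w ^+ 2) = (fun w => g w * g w)) //.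
rewrite -RintegralB// -RintegralD//.
by apply: eq_Rintegral => w _; ring.
Qed.

(** For each [k] the intersection of the [B k m] over [m] has probability below every [eta]. In the
    uses, [B k m] is the event that a bound of order [1 / (k + 1)] fails at some listed time after
    [m]. *)
Lemma ae_eventually (B : nat -> nat -> set Omega) : (forall k m, measurable (B k m)) ->
  (forall k (eta : R), 0 < eta -> exists m, (P (B k m) <= eta%:E)%E) ->
  {ae P, forall w, forall k, exists m, ~ B k m w}.
Proof.
move=> mB Beta; apply: ae_foralln => k.
exists (\bigcap_m B k m); split.
- exact: bigcapT_measurable.
- apply/eqP; rewrite eq_le measure_ge0 andbT; apply/lee_addgt0Pr => eta eta0.
  have [m Bm] := Beta k eta eta0; rewrite add0e; apply: le_trans Bm.
  by apply: le_measure; rewrite ?inE//; [exact: bigcapT_measurable|exact: bigcap_inf].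
- by move=> w /= /forallNP H m _; apply: contrapT; exact: H.
Qed.

Section set_martingale.
Variable Fil : set (set Omega).
Hypothesis Fil_measurable : Fil `<=` measurable.
Hypothesis Fil_I : forall A B, Fil A -> Fil B -> Fil (A `&` B).

(** The sum counts the positive integers up to [y], that is, the integer part of [y]; [y < m + 1]
    ensures that none is missed. *)
Lemma step_approx (y : R) m : 0 <= y < m.+1%:R ->
  \sum_(k < m) (k.+1%:R <= y)%R%:R <= y <= \sum_(k < m) (k.+1%:R <= y)%R%:R + 1.
Proof.
elim: m => [|m IH] /andP[y0 ym]; first by rewrite big_ord0 y0 add0r ltW.
rewrite big_ord_recr/=; have [my|ym'] := leP m.+1%:R y; last first.
  by rewrite addr0; apply: IH; rewrite y0.
rewrite (eq_bigr (fun=> 1)); last first.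
  move=> i _; rewrite (_ : _ <= y)//; apply: le_trans my; rewrite ler_nat.
  exact: leqW (ltn_ord i).
rewrite sumr_const card_ord natr1 my/=.
by apply: ltW; move: ym; rewrite -[in X in X -> _]natr1.
Qed.

(* [Fil] plays the role of the past at some time and [M1], [M2] of two later
   values of a martingale; [Z] is approximated from below by the step function
   [sum_k (1 / n) 1_(Z >= k / n)], whose level sets are in [Fil]. *)
Lemma set_martingale_mul_le C (M1 M2 Z : Omega -> R) A :
  measurable_fun setT M1 -> measurable_fun setT M2 -> measurable_fun setT Z ->
  (forall w, 0 <= M1 w <= C) -> (forall w, 0 <= M2 w <= C) -> (forall w, 0 <= Z w <= C) ->
  (forall a, Fil [set w | a <= Z w]) -> Fil A ->
  (forall B, Fil B -> Rintegral P B M1 = Rintegral P B M2) ->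
  Rintegral P A (fun w => Z w * M1 w) <= Rintegral P A (fun w => Z w * M2 w).
Proof.
move=> mM1 mM2 mZ M1C M2C ZC FZ FA EM.
have mA := Fil_measurable _ FA.
have C0 : 0 <= C by have /andP[] := M1C point; exact: le_trans.
apply/ler_addgt0Pr => e e0.
(* The mesh [1 / (n + 1)] makes the approximation error, at most [C / (n + 1)], smaller than [e];
   [m] then provides enough steps to reach the bound [C] of [Z]. *)
have [n _ Hn] := nbhs_infty_ger ((C + 1) / e).
have {Hn} n0 : (C + 1) / e <= n.+1%:R by apply: (Hn n.+1) => /=.
have [m _ Hm] := nbhs_infty_ger (n.+1%:R * C).
have {Hm} mC : n.+1%:R * C < m.+1%:R.
  by rewrite (le_lt_trans (Hm m (leqnn m)))// ltr_nat.
pose E k := [set w | k.+1%:R / n.+1%:R <= Z w].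
pose g w := n.+1%:R^-1 * \sum_(k < m) \1_(E k) w : R.
have n10 : 0 < n.+1%:R^-1 :> R by rewrite invr_gt0.
have gZ w : g w <= Z w <= g w + n.+1%:R^-1.
  have /andP[Z0 ZCw] := ZC w.
  have := @step_approx (n.+1%:R * Z w) m.
  rewrite mulr_ge0//= => /(_ _)/andP[|h1 h2].
    by apply: le_lt_trans mC; rewrite ler_wpM2l.
  have sE : \sum_(k < m) \1_(E k) w = \sum_(k < m) (k.+1%:R <= n.+1%:R * Z w)%R%:R :> R.
    apply: eq_bigr => k _; rewrite indicE; congr (_%:R); congr nat_of_bool.
    apply/idP/idP => [/set_mem|]; rewrite /E/= ?ler_pdivrMr// ?[Z w * _]mulrC//.
    by move=> h; apply/mem_set; rewrite /E/= ler_pdivrMr// mulrC.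
  rewrite /g sE; apply/andP; split.
    by rewrite [leLHS]mulrC ler_pdivrMr// [Z w * _]mulrC.
  by rewrite -[X in _ + X]mulr1 -mulrDr [leRHS]mulrC ler_pdivlMr// [Z w * _]mulrC.
have mE k : measurable (E k) by apply: Fil_measurable; exact: FZ.
have mS m' : measurable_fun setT (fun w => \sum_(k < m') \1_(E k) w : R).
  by apply: measurable_sum => k; exact: measurable_indic.
have sE1 m' w : `|\sum_(k < m') \1_(E k) w| <= m'%:R :> R.
  rewrite ger0_norm ?sumr_ge0// -[m' in leRHS]card_ord -sumr_const.
  by apply: ler_sum => k _; rewrite indicE; case: (_ \in _).
have mg : measurable_fun setT g by exact: measurable_funM.
have iM (M : Omega -> R) A' : measurable_fun setT M -> (forall w, 0 <= M w <= C) -> measurable A' ->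
    P.-integrable A' (EFin \o M).
  move=> mM MC mA'; apply: (bounded_integrable C) => // w.
  by have /andP[M0 MCw] := MC w; rewrite ger0_norm.
have ES (M : Omega -> R) : measurable_fun setT M -> (forall w, 0 <= M w <= C) ->
    Rintegral P A (fun w => (\sum_(k < m) \1_(E k) w) * M w) =
    \sum_(k < m) Rintegral P (A `&` E k) M.
  move=> mM MC; elim: {mC gZ mg g} m => [|m' IH].
    rewrite big_ord0; under eq_Rintegral do rewrite big_ord0 mul0r.
    by rewrite Rintegral_cst// mul0r.
  rewrite big_ord_recr/= -IH (@Rintegral_mkcondr _ Omega R P A (E m') M) -RintegralD//.
  - apply: eq_Rintegral => w _; rewrite big_ord_recr/= mulrDl; congr (_ + _).
    by rewrite patchE indicE; case: ifP => _; rewrite ?mul1r ?mul0r.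
  - apply: (bounded_integrable (m'%:R * C)) => //; first exact: measurable_funM.
    move=> w; have /andP[M0 MCw] := MC w.
    by rewrite normrM ler_pM// ?(ger0_norm M0)// sE1.
  - by rewrite -restrict_EFin; apply/integrable_restrict => //=; apply: iM => //; exact: measurableI.
have Eg (M : Omega -> R) : measurable_fun setT M -> (forall w, 0 <= M w <= C) ->
    Rintegral P A (fun w => g w * M w) = n.+1%:R^-1 * \sum_(k < m) Rintegral P (A `&` E k) M.
  move=> mM MC; rewrite -ES// -RintegralZl//.
    by apply: eq_Rintegral => w _; rewrite /g mulrA.
  apply: (bounded_integrable (m%:R * C)) => //; first exact: measurable_funM.
  move=> w; have /andP[M0 MCw] := MC w.
  by rewrite normrM ler_pM// ?(ger0_norm M0)// sE1.
(* The step function reduces the products to integrals of [M1] and [M2] over the events [A]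
   intersected with [E k], which belong to [Fil]. *)
have EE : Rintegral P A (fun w => g w * M1 w) = Rintegral P A (fun w => g w * M2 w).
  rewrite !Eg//; congr (_ * _); apply: eq_bigr => k _; apply: EM.
  by apply: Fil_I => //; exact: FZ.
have g0 w : 0 <= g w by rewrite /g mulr_ge0 ?(ltW n10)// sumr_ge0.
have CC w (M : Omega -> R) : 0 <= M w <= C -> 0 <= Z w * M w <= C * C.
  move=> /andP[M0 MC]; have /andP[Z0 ZCw] := ZC w.
  by rewrite mulr_ge0//= ler_pM.
have b1 w : `|Z w * M1 w| <= C * C + n.+1%:R^-1 * C.
  have /andP[h1 h2] := CC w M1 (M1C w).
  by rewrite ger0_norm// (le_trans h2)// lerDl mulr_ge0// ltW.
have gM0 (M : Omega -> R) w : 0 <= M w <= C -> 0 <= g w * M w <= Z w * M w.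
  move=> /andP[M0 MC]; have /andP[h1 _] := gZ w.
  by rewrite mulr_ge0//= ler_wpM2r.
have n1M w : 0 <= n.+1%:R^-1 * M1 w <= n.+1%:R^-1 * C.
  by have /andP[h1 h2] := M1C w; rewrite mulr_ge0 ?(ltW n10)//= ler_wpM2l ?(ltW n10).
have i1 : P.-integrable A (EFin \o (fun w => g w * M1 w)).
  apply: (bounded_integrable (C * C)) => //; first exact: measurable_funM.
  move=> w; have /andP[h1 h2] := gM0 M1 w (M1C w).
  by rewrite ger0_norm// (le_trans h2)//; have /andP[] := CC w M1 (M1C w).
have i2 : P.-integrable A (EFin \o (fun w => n.+1%:R^-1 * M1 w)).
  apply: (bounded_integrable (n.+1%:R^-1 * C)) => //; first exact: measurable_funM.
  by move=> w; have /andP[h1 h2] := n1M w; rewrite ger0_norm.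
apply: (@le_trans _ _ (Rintegral P A (fun w => g w * M1 w) +
                       Rintegral P A (fun w => n.+1%:R^-1 * M1 w))).
  rewrite -RintegralD//; apply: (le_Rintegral_bounded (C * C + n.+1%:R^-1 * C)) => //.
  - exact: measurable_funM.
  - by apply: measurable_funD; exact: measurable_funM.
  - move=> w; have /andP[h1 h2] := gM0 M1 w (M1C w); have /andP[h3 h4] := n1M w.
    rewrite ger0_norm ?addr_ge0// lerD// (le_trans h2)//.
    by have /andP[] := CC w M1 (M1C w).
  - move=> w _; rewrite -mulrDl ler_wpM2r//; first by have /andP[] := M1C w.
    by have /andP[] := gZ w.
rewrite EE lerD//.
  apply: (le_Rintegral_bounded (C * C)) => //.
  - exact: measurable_funM.
  - exact: measurable_funM.
  - move=> w; have /andP[h1 h2] := gM0 M2 w (M2C w).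
    by rewrite ger0_norm// (le_trans h2)//; have /andP[] := CC w M2 (M2C w).
  - by move=> w; have /andP[h1 h2] := CC w M2 (M2C w); rewrite ger0_norm.
  - by move=> w _; have /andP[] := gM0 M2 w (M2C w).
apply: (@le_trans _ _ (Rintegral P A (cst (n.+1%:R^-1 * C)))).
  apply: (le_Rintegral_bounded (n.+1%:R^-1 * C)) => //.
  - exact: measurable_funM.
  - by move=> w; have /andP[h1 h2] := n1M w; rewrite ger0_norm.
  - by move=> w; rewrite /= ger0_norm// mulr_ge0// ltW.
  - by move=> w _; have /andP[] := n1M w.
rewrite Rintegral_cst//.
have PA : 0 <= fine (P A) <= 1.
  rewrite fine_ge0//= -lee_fin fineK ?probability_le1//.
  exact: fin_num_measure.
apply: (@le_trans _ _ (n.+1%:R^-1 * C)).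
  by rewrite ler_piMr ?mulr_ge0 ?(ltW n10)//; case/andP: PA.
rewrite mulrC ler_pdivrMr// mulrC.
by move: n0; rewrite ler_pdivrMr//; lra.
Qed.

End set_martingale.
End bounded_integrals.

(** * Doob's inequality and convergence of martingales *)

Section bounded_martingales.
Context d (Omega : measurableType d) (R : realType) (P : probability Omega R).
Variable gen : R -> set (set Omega).
Hypothesis gen_measurable : forall t, gen t `<=` measurable.
Hypothesis gen_le : forall s t, s <= t -> gen s `<=` gen t.
Implicit Types (s t : R) (A : set Omega) (f : Omega -> R).

Local Notation past t := (<<s gen t >>).

Definition adapted t f :=
  measurable_fun (setT : set (g_sigma_algebraType (gen t))) f.

Lemma past_measurable t : past t `<=` measurable.
Proof.
apply: smallest_sub; last exact: gen_measurable.
split; [exact: measurable0| |exact: bigcupT_measurable].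
by move=> A mA; rewrite setTD; exact: measurableC.
Qed.

Lemma past_le s t : s <= t -> past s `<=` past t.
Proof. by move=> st; apply: sub_sigma_algebra2; exact: gen_le. Qed.

Lemma past_setT t : past t setT.
Proof. exact: (@measurableT _ (g_sigma_algebraType (gen t))). Qed.

Lemma past_setI t A B : past t A -> past t B -> past t (A `&` B).
Proof. exact: (@measurableI _ (g_sigma_algebraType (gen t))). Qed.

Lemma past_setU t A B : past t A -> past t B -> past t (A `|` B).
Proof. exact: (@measurableU _ (g_sigma_algebraType (gen t))). Qed.

Lemma past_setD t A B : past t A -> past t B -> past t (A `\` B).
Proof. exact: (@measurableD _ (g_sigma_algebraType (gen t))). Qed.

Lemma adapted_measurable t f : adapted t f -> measurable_fun setT f.
Proof.
move=> af _ B mB; apply: (past_measurable t).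
by apply: af => //; exact: (@measurableT _ (g_sigma_algebraType (gen t))).
Qed.

Lemma adapted_le s t f : s <= t -> adapted s f -> adapted t f.
Proof.
move=> st af _ B mB; apply: (past_le s t st).
by apply: af => //; exact: (@measurableT _ (g_sigma_algebraType (gen s))).
Qed.

Lemma adapted_ge t f a : adapted t f -> past t [set w | a <= f w].
Proof.
move=> af; have := af measurableT `[a, +oo[%classic (measurable_itv _).
rewrite setTI (_ : f @^-1` _ = [set w | a <= f w])//.
by apply/seteqP; split => w /=; rewrite in_itv/= andbT.
Qed.

(** * Doob's maximal inequality for nonnegative submartingales *)

Section maximal_inequality.
Variables (X : R -> Omega -> R) (C : R -> R) (t0 : R).
Hypothesis X_bound : forall t w, t0 <= t -> 0 <= X t w <= C t.
Hypothesis X_adapted : forall t, t0 <= t -> adapted t (X t).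
Hypothesis X_sub : forall s t A, t0 <= s -> s <= t -> past s A ->
  Rintegral P A (X s) <= Rintegral P A (X t).

Let mX t : t0 <= t -> measurable_fun setT (X t).
Proof. by move=> /X_adapted/adapted_measurable. Qed.

Let X_norm t w : t0 <= t -> `|X t w| <= C t.
Proof. by move=> /X_bound-/(_ w)/andP[h1 h2]; rewrite ger0_norm. Qed.

Let iX t A : t0 <= t -> measurable A -> P.-integrable A (EFin \o X t).
Proof.
by move=> tt mA; apply: (bounded_integrable _ _ _ _ (C t)) => // [|w]; [exact: mX|exact: X_norm].
Qed.

Definition exceed (e : R) (l : seq R) := [set w | exists2 r, r \in l & e <= X r w].

(* [l] is listed by decreasing times, so that the induction adds the latest. *)
Lemma maximal_inequality_path e r l : path >=%R r l -> all (>= t0) (r :: l) ->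
  past r (exceed e (r :: l)) /\
  e * fine (P (exceed e (r :: l))) <= Rintegral P (exceed e (r :: l)) (X r).
Proof.
elim: l r => [|q l IH] r /=.
  move=> _; rewrite andbT => tr.
  have -> : exceed e [:: r] = [set w | e <= X r w].
    apply/seteqP; split => [w [s]|w h]; first by rewrite inE => /eqP ->.
    by exists r => //; rewrite inE.
  have Fr := adapted_ge _ _ e (X_adapted _ tr); split => //.
  have mA := past_measurable _ _ Fr.
  rewrite -Rintegral_cst//; apply: le_Rintegral => //; last exact: iX.
  by apply: (bounded_integrable _ _ _ _ `|e|).
move=> /andP[qr pl] /andP[tr tl].
have [FU IHU] := IH q pl tl; have /andP[tq _] := tl.
set U := exceed e (q :: l) in FU IHU *.
(* On [D] the level is reached only at the latest time [r], where [X r >= e]. On [U] it was reached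
   by time [q], so the induction hypothesis applies and the submartingale property moves the
   integral from [q] to [r]. *)
pose D := [set w | e <= X r w] `\` U.
have FU' := past_le _ _ qr _ FU.
have FD : past r D by apply: past_setD => //; exact: adapted_ge (X_adapted _ tr).
have mU := past_measurable _ _ FU'; have mD := past_measurable _ _ FD.
have -> : exceed e [:: r, q & l] = U `|` D.
  apply/seteqP; split => [w [s]|w [[s sl h]|[h _]]].
  - rewrite inE => /orP[/eqP ->|sl] h; last by left; exists s.
    by have [Uw|nUw] := pselect (U w); [left|right].
  - by exists s => //; rewrite inE sl orbT.
  - by exists r => //; rewrite inE eqxx.
have UD : [disjoint U & D] by apply/disj_setPS => w [Uw [_]].
split; first exact: past_setU.
have fin A : measurable A -> P A \is a fin_num by move=> mA; exact: fin_num_measure.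
rewrite measureU//; last by apply/disj_set2P.
rewrite fineD ?fin// mulrDr Rintegral_setU//; last by apply: iX => //; exact: measurableU.
rewrite lerD//; first by apply: le_trans IHU _; exact: X_sub.
rewrite -Rintegral_cst//; apply: le_Rintegral => //.
- by apply: (bounded_integrable _ _ _ _ `|e|).
- exact: iX.
- by move=> w [].
Qed.

Lemma maximal_inequality e l t : all (>= t0) l -> all (<= t) l -> t0 <= t ->
  measurable (exceed e l) /\ e * fine (P (exceed e l)) <= Rintegral P setT (X t).
Proof.
move=> tl lt tt; pose l' := sort >=%R l.
have -> : exceed e l = exceed e l'.
  by apply/seteqP; split => w [s sl h]; exists s => //; rewrite mem_sort in sl *.
have X0 A : 0 <= Rintegral P A (X t).
  by apply: Rintegral_ge0 => w _; have /andP[] := X_bound t w tt.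
have : sorted >=%R l' by apply: sort_sorted => x y; exact: le_total.
have : all (>= t0) l' by rewrite all_sort.
have : all (<= t) l' by rewrite all_sort.
case: l' => [_ _ _|r l'' lt' tl' sl].
  have -> : exceed e [::] = set0 by apply/seteqP; split => // w [].
  by rewrite measure0 mulr0.
have [FU h] := maximal_inequality_path e r l'' sl tl'.
have mU := past_measurable _ _ FU; split => //.
apply: (le_trans h); have /andP[tr _] := tl'; have /andP[rt _] := lt'.
apply: (le_trans (X_sub _ _ _ tr rt FU)).
rewrite -(setvU (exceed e (r :: l''))) Rintegral_setU//.
- by rewrite lerDr.
- exact: measurableC.
- by rewrite setvU; exact: iX.
- by apply/disj_setPS => w [].
Qed.

Lemma maximal_inequality_countable e B (tau : nat -> R) : 0 < e ->
  (forall n, t0 <= tau n) -> (forall t, t0 <= t -> Rintegral P setT (X t) <= B) ->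
  measurable [set w | exists n, e <= X (tau n) w] /\
  (P [set w | exists n, (e <= X (tau n) w)%R] <= (B / e)%:E)%E.
Proof.
move=> e0 ttau XB.
pose l n := map tau (iota 0 n).
have tl n : all (>= t0) (l n) by apply/allP => _ /mapP[k _ ->].
have bnd n : exists2 t, t0 <= t & all (<= t) (l n).
  elim: n => [|n [t tt h]]; first by exists t0.
  exists (Num.max t (tau n)); first by rewrite le_max tt.
  rewrite /l -addn1 iotaD map_cat all_cat /= add0n le_max lexx orbT !andbT.
  by apply/allP => s /(allP h) /= st; rewrite le_max st.
have H n : measurable (exceed e (l n)) /\ (P (exceed e (l n)) <= (B / e)%:E)%E.
  have [t tt lt] := bnd n; have [mE h] := maximal_inequality e _ t (tl n) lt tt.
  split => //; rewrite -[P _]fineK; last exact: fin_num_measure.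
  rewrite lee_fin ler_pdivlMr// mulrC; apply: (le_trans h); exact: XB.
have -> : [set w | exists n, e <= X (tau n) w] = \bigcup_n exceed e (l n).
  apply/seteqP; split => [w [n h]|w [n _ [_ /mapP[k _ ->] h]]]; last by exists k.
  exists n.+1 => //; exists (tau n) => //; apply/mapP; exists n => //.
  by rewrite mem_iota /= add0n.
have mU : measurable (\bigcup_n exceed e (l n)).
  by apply: bigcupT_measurable => n; have [] := H n.
split => //.
have cv : P (exceed e (l n)) @[n --> \oo] --> P (\bigcup_n exceed e (l n)).
  apply: nondecreasing_cvg_mu => //; first by move=> n; have [] := H n.
  apply/nondecreasing_seqP => n; rewrite subsetEset => w [s sl h]; exists s => //.
  by rewrite /l -addn1 iotaD map_cat mem_cat sl.
rewrite -(cvg_lim _ cv)//; apply: lime_le; first exact: cvgP cv.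
by apply: nearW => n; have [] := H n.
Qed.

End maximal_inequality.

(** * From a dense sequence of times to all times *)

Section right_continuous_paths.
Implicit Types (g : R -> R).

(** For fixed [m] this sequence runs through all times [m + |q|] with [q] rational. The absolute
    value and the default 0 for codes of no rational keep every term at or after [m]. *)
Definition rational_time (m : nat) (n : nat) : R :=
  m%:R + `|ratr (odflt 0 (unpickle n : option rat))|.

Lemma rational_time_ge m n : m%:R <= rational_time m n.
Proof. by rewrite lerDl. Qed.

Lemma rational_time_dense m s t : m%:R <= s -> s < t ->
  exists n, s < rational_time m n < t.
Proof.
move=> ms st; have smtm : s - m%:R < t - m%:R by rewrite ltrD2r.
have [q] := rat_in_itvoo smtm; rewrite in_itv/= => /andP[q1 q2].
exists (pickle q); rewrite /rational_time pickleK/= ger0_norm; last first.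
  by apply: le_trans (ltW q1); rewrite subr_ge0.
by rewrite -ltrBlDl q1/= -ltrBrDl.
Qed.

Lemma right_cvg_dist_le g m c e :
  (forall t, 0 <= t -> g x @[x --> t^'+] --> g t) ->
  (forall n, `|g (rational_time m n) - c| <= e) ->
  forall t, m%:R <= t -> `|g t - c| <= e.
Proof.
move=> gc ge t mt; apply/ler_addgt0Pr => eta eta0.
have t0 : 0 <= t by apply: le_trans mt.
have /(@cvgrPdist_le _ R^o)/(_ eta eta0)[r /= r0 H] := gc t t0.
have [n /andP[tn nt]] := rational_time_dense m t (t + r) mt (ltr_pwDr r0 (lexx t)).
have h : `|g t - g (rational_time m n)| <= eta.
  by apply: H => //=; rewrite distrC gtr0_norm ?subr_gt0// ltrBlDl.
rewrite (_ : g t - c = (g (rational_time m n) - c) + (g t - g (rational_time m n))); last by ring.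
by apply: (le_trans (ler_normD _ _)); rewrite lerD.
Qed.

Lemma cvg_of_rational_cauchy g :
  (forall t, 0 <= t -> g x @[x --> t^'+] --> g t) ->
  (forall k : nat, exists m, forall n, `|g (rational_time m n) - g m%:R| <= k.+1%:R^-1) ->
  cvg (g x @[x --> +oo]).
Proof.
move=> gc gC; apply/cauchy_cvgP; apply: cauchy_exP => e e0.
have [k _ Hk] := nbhs_infty_ger (2 / e).
have {}Hk : k.+1%:R^-1 < e.
  have := Hk k (leqnn k); rewrite /= ler_pdivrMr// => h.
  rewrite -[ltLHS]mul1r ltr_pdivrMr// -natr1; nra.
have [m Hm] := gC k.
exists (g m%:R); change (\forall t \near +oo, ball (g m%:R) e (g t)); near=> t.
rewrite /ball/= distrC; apply: le_lt_trans Hk.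
by apply: (right_cvg_dist_le g m).
Unshelve. all: by end_near. Qed.

Lemma cvg0_of_rational g :
  (forall t, 0 <= t -> g x @[x --> t^'+] --> g t) ->
  (forall k : nat, exists m, forall n, `|g (rational_time m n)| <= k.+1%:R^-1) ->
  g x @[x --> +oo] --> 0.
Proof.
move=> gc gC; apply/(@cvgrPdist_le _ R^o) => e e0.
have [k _ Hk] := nbhs_infty_ger (2 / e).
have {}Hk : k.+1%:R^-1 < e.
  have := Hk k (leqnn k); rewrite /= ler_pdivrMr// => h.
  rewrite -[ltLHS]mul1r ltr_pdivrMr// -natr1; nra.
have [m Hm] := gC k.
near=> t; rewrite distrC; apply: (@le_trans _ _ k.+1%:R^-1); last exact: ltW.
by apply: (right_cvg_dist_le g m) => // n; rewrite subr0.
Unshelve. all: by end_near. Qed.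

End right_continuous_paths.

(** * Almost sure limits of nonnegative martingales *)

Section martingale.
Variables (N : R -> Omega -> R) (C : R -> R).
Hypothesis N_bound : forall t w, 0 <= t -> 0 <= N t w <= C t.
Hypothesis N_adapted : forall t, 0 <= t -> adapted t (N t).
Hypothesis N_mart : forall s t A, 0 <= s -> s <= t -> past s A ->
  Rintegral P A (N s) = Rintegral P A (N t).

Let mN t : 0 <= t -> measurable_fun setT (N t).
Proof. by move=> t0; apply: (adapted_measurable t); exact: N_adapted. Qed.

Lemma rational_time_ge0 m n : 0 <= rational_time m n.
Proof. by rewrite addr_ge0. Qed.

Lemma martingale_maximal e m : 0 < e ->
  measurable [set w | exists n, e <= N (rational_time m n) w] /\
  (P [set w | exists n, (e <= N (rational_time m n) w)%R] <= (Rintegral P setT (N 0) / e)%:E)%E.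
Proof.
move=> e0; have m0 : 0 <= m%:R :> R by [].
apply: (maximal_inequality_countable N C m%:R) => //.
- by move=> t w mt; apply: N_bound; exact: le_trans mt.
- by move=> t mt; apply: N_adapted; exact: le_trans mt.
- by move=> s t A ms st FA; rewrite (N_mart _ _ _ _ st FA)//; exact: le_trans ms.
- by move=> n; exact: rational_time_ge.
- by move=> t mt; rewrite -(N_mart 0 t setT)//; [exact: le_trans mt|exact: past_setT].
Qed.

(** The level [c j m] is such that [k m * c j m = 1 / (j + 1)]. As [k] decreases, [k * N] stays
    below [1 / (j + 1)] after [m] unless [N] exceeds [c j m]. By the maximal inequality this has
    probability at most [E0 * (j + 1) * k m], which vanishes as [m] grows. *)
Lemma damped_martingale_cvg0 (k : R -> R) : (forall t, 0 <= t -> 0 < k t) ->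
  (forall s t, 0 <= s -> s <= t -> k t <= k s) -> k t @[t --> +oo] --> 0 ->
  (forall w t, 0 <= t -> k x * N x w @[x --> t^'+] --> k t * N t w) ->
  {ae P, forall w, k t * N t w @[t --> +oo] --> 0}.
Proof.
move=> k0 kle kcvg kNc.
pose c j (m : nat) := (j.+1%:R * k m%:R)^-1.
have c0 j m : 0 < c j m by rewrite invr_gt0 mulr_gt0// k0.
pose B j m := [set w | exists n, c j m <= N (rational_time m n) w].
have mB j m : measurable (B j m) by have [] := martingale_maximal (c j m) m (c0 j m).
have EN0 : 0 <= Rintegral P setT (N 0).
  by apply: Rintegral_ge0 => w _; have /andP[] := N_bound 0 w (lexx _).
set E0 := Rintegral P setT (N 0) in EN0.
apply: (filterS _ (ae_eventually _ _ _ P B mB _)); last first.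
  move=> j eta eta0.
  (* The mean [E0] may be 0, hence [E0 + 1] in the denominator. *)
  have d0 : 0 < eta / (j.+1%:R * (E0 + 1)) by rewrite divr_gt0 ?mulr_gt0//; lra.
  have /(@cvgrPdist_le _ R^o)/(_ _ d0)[T [_ HT]] := kcvg.
  have [m _ Hm] := nbhs_infty_ger (T + 1).
  have Tm : T < m%:R by have := Hm m (leqnn m); rewrite /=; lra.
  have := HT _ Tm; rewrite sub0r normrN gtr0_norm ?k0// ler_pdivlMr ?mulr_gt0//; last lra.
  move=> h; exists m; have [_ hB] := martingale_maximal (c j m) m (c0 j m).
  apply: (le_trans hB); rewrite lee_fin /c invrK -/E0.
  have jk : 0 < j.+1%:R * k m%:R by rewrite mulr_gt0// k0.
  nra.
move=> w Hw; apply: cvg0_of_rational; first exact: kNc.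
move=> j; have [m nB] := Hw j; exists m => n.
have tm := rational_time_ge m n; have t0 := rational_time_ge0 m n.
have Nc : N (rational_time m n) w < c j m.
  by rewrite ltNge; apply/negP => h; apply: nB; exists n.
have /andP[N0 _] := N_bound _ w t0.
rewrite ger0_norm ?mulr_ge0 ?(ltW (k0 _ t0))//.
have km := k0 m%:R (ler0n _ _).
apply: (@le_trans _ _ (k m%:R * c j m)).
  by rewrite ler_pM ?(ltW (k0 _ t0)) ?(ltW Nc) ?kle.
by rewrite /c invfM mulrCA divff ?mulr1// gt_eqF.
Qed.

Section bounded.
Variable D : R.
Hypothesis C_le : forall t, 0 <= t -> C t <= D.

Let N_D t w : 0 <= t -> 0 <= N t w <= D.
Proof. by move=> t0; have /andP[-> h] /= := N_bound t w t0; exact: le_trans (C_le _ t0). Qed.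

Let N_norm t w : 0 <= t -> `|N t w| <= D.
Proof. by move=> t0; have /andP[h1 h2] := N_D t w t0; rewrite ger0_norm. Qed.

(** The one-sided comparison is used twice, with [N s] and [N t] exchanged. *)
Lemma martingale_mul s t Z A : 0 <= s -> s <= t -> past s A -> adapted s Z ->
  (forall w, 0 <= Z w <= D) ->
  Rintegral P A (fun w => Z w * N s w) = Rintegral P A (fun w => Z w * N t w).
Proof.
move=> s0 st FA aZ ZD; have t0 := le_trans s0 st.
have mZ := adapted_measurable _ _ aZ.
have FZ a : past s [set w | a <= Z w] by exact: adapted_ge.
have ND r : 0 <= r -> forall w, 0 <= N r w <= D by move=> r0 w; exact: N_D.
apply/eqP; rewrite eq_le; apply/andP; split.
  apply: (@set_martingale_mul_le _ _ _ P (past s) (past_measurable s) (past_setI s) D) => //;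
    [exact: mN|exact: mN|exact: ND|exact: ND|].
  by move=> B FB; exact: N_mart.
apply: (@set_martingale_mul_le _ _ _ P (past s) (past_measurable s) (past_setI s) D) => //;
  [exact: mN|exact: mN|exact: ND|exact: ND|].
by move=> B FB; apply/esym; exact: N_mart.
Qed.

Let sqrB s t A : 0 <= s -> 0 <= t -> measurable A ->
  Rintegral P A (fun w => (N s w - N t w) ^+ 2) =
  Rintegral P A (fun w => N s w ^+ 2) - 2 * Rintegral P A (fun w => N t w * N s w) +
  Rintegral P A (fun w => N t w ^+ 2).
Proof.
move=> s0 t0 mA; rewrite (Rintegral_sqrB _ _ _ P D)//; first last.
- by move=> w; exact: N_norm.
- by move=> w; exact: N_norm.
- exact: mN.
- exact: mN.
by congr (_ - 2 * _ + _); apply: eq_Rintegral => w _; rewrite mulrC.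
Qed.

Lemma martingale_sqr_le s t A : 0 <= s -> s <= t -> past s A ->
  Rintegral P A (fun w => N s w ^+ 2) <= Rintegral P A (fun w => N t w ^+ 2).
Proof.
move=> s0 st FA; have t0 := le_trans s0 st; have mA := past_measurable _ _ FA.
have : 0 <= Rintegral P A (fun w => (N t w - N s w) ^+ 2).
  by apply: Rintegral_ge0 => w _; exact: sqr_ge0.
rewrite sqrB//.
rewrite -(martingale_mul s t (N s) A s0 st FA (N_adapted _ s0)); last by move=> w; exact: N_D.
rewrite (_ : (fun w => N s w * N s w) = (fun w => N s w ^+ 2))//.
lra.
Qed.

(** After expanding the squares, the cross terms with [N r] agree at times [s] and [t], leaving the
    submartingale property of [N ^+ 2]. It allows the maximal inequality to be applied to increments
    after a fixed time. *)
Lemma martingale_sqr_diff r s t A : 0 <= r -> r <= s -> s <= t -> past s A ->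
  Rintegral P A (fun w => (N s w - N r w) ^+ 2) <=
  Rintegral P A (fun w => (N t w - N r w) ^+ 2).
Proof.
move=> r0 rs st FA; have s0 := le_trans r0 rs; have t0 := le_trans s0 st.
have mA := past_measurable _ _ FA.
rewrite !sqrB//.
rewrite (martingale_mul s t (N r) A s0 st FA (adapted_le _ _ _ rs (N_adapted _ r0))).
  by rewrite lerD2r lerD2r martingale_sqr_le.
by move=> w; exact: N_D.
Qed.

(** The second moments [a t] increase to a finite supremum [L], and orthogonality of increments
    gives [a t - a m] as the mean square of [N t - N m]. The maximal inequality bounds by
    [(L - a m) * (k + 1) ^ 2] the probability that some listed increment after [m] reaches
    [1 / (k + 1)]. This is small for suitable [m], so almost every path is Cauchy. *)
Lemma bounded_martingale_cvg :
  (forall w t, 0 <= t -> N x w @[x --> t^'+] --> N t w) ->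
  {ae P, forall w, cvg (N t w @[t --> +oo])}.
Proof.
move=> N_rc; pose a t := Rintegral P setT (fun w => N t w ^+ 2).
have a_le s t : 0 <= s -> s <= t -> a s <= a t.
  by move=> s0 st; apply: martingale_sqr_le => //; exact: past_setT.
have D0 : 0 <= D by have /andP[h1 h2] := N_D 0 point (lexx _); exact: le_trans h2.
have sqrD t w : 0 <= t -> 0 <= N t w ^+ 2 <= D ^+ 2.
  move=> t0; have /andP[h1 h2] := N_D t w t0; rewrite sqr_ge0/=.
  by rewrite ler_pXn2r ?nnegrE.
have a_bd t : 0 <= t -> a t <= D ^+ 2.
  move=> t0; have -> : D ^+ 2 = Rintegral P setT (cst (D ^+ 2)).
    rewrite Rintegral_cst// -[LHS]mulr1; congr (_ * _).
    exact: esym (congr1 fine (probability_setT P)).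
  apply: (le_Rintegral_bounded _ _ _ P (D ^+ 2)) => //.
  - by apply: measurable_funX; exact: mN.
  - by move=> w; have /andP[h1 h2] := sqrD t w t0; rewrite ger0_norm.
  - by move=> w; rewrite /= ger0_norm ?sqr_ge0.
  - by move=> w _; have /andP[] := sqrD t w t0.
pose E := range (fun n : nat => a n%:R); pose L := sup E.
have supE : has_sup E.
  split; first by exists (a 0%:R); exists 0%N.
  by exists (D ^+ 2) => _ [n _ <-]; exact: a_bd.
have aL t : 0 <= t -> a t <= L.
  move=> t0; have [n _ Hn] := nbhs_infty_ger t.
  apply: (le_trans (a_le _ n%:R t0 (Hn n (leqnn n)))).
  by apply: sup_upper_bound => //; exists n.
have diffE m t : 0 <= m -> m <= t ->
    Rintegral P setT (fun w => (N t w - N m w) ^+ 2) = a t - a m.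
  move=> m0 mt; have t0 := le_trans m0 mt; rewrite sqrB//.
  rewrite -(martingale_mul m t (N m) setT m0 mt (past_setT _) (N_adapted _ m0)); last first.
    by move=> w; exact: N_D.
  rewrite (_ : (fun w => N m w * N m w) = (fun w => N m w ^+ 2))// -/(a t) -/(a m).
  ring.
pose e (k : nat) : R := k.+1%:R^-1 ^+ 2.
have e0 k : 0 < e k by rewrite exprn_gt0// invr_gt0.
pose B k m := [set w | exists n, e k <= (N (rational_time m n) w - N m%:R w) ^+ 2].
have BP k m : measurable (B k m) /\ (P (B k m) <= ((L - a m%:R) / e k)%:E)%E.
  have m0 : 0 <= m%:R :> R by [].
  apply: (maximal_inequality_countable (fun t w => (N t w - N m%:R w) ^+ 2)
    (fun=> D ^+ 2) m%:R) => //.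
  - move=> t w mt; have /andP[h1 h2] := N_D t w (le_trans m0 mt).
    have /andP[h3 h4] := N_D m%:R w m0; rewrite sqr_ge0/=.
    rewrite -[leLHS]real_normK ?num_real// ler_pXn2r ?nnegrE// ler_norml.
    by apply/andP; split; lra.
  - move=> t mt; have t0 := le_trans m0 mt.
    apply: measurable_funX; apply: measurable_funB; first exact: N_adapted.
    exact: adapted_le mt (N_adapted _ m0).
  - by move=> s t A ms st FA; exact: martingale_sqr_diff.
  - by move=> n; exact: rational_time_ge.
  - by move=> t mt; rewrite diffE// lerD2r aL// (le_trans m0).
have mB k m : measurable (B k m) by have [] := BP k m.
apply: (filterS _ (ae_eventually _ _ _ P B mB _)); last first.
  move=> k eta eta0; have d0 : 0 < eta * e k by rewrite mulr_gt0.
  have [_ [m _ <-] Lm] := sup_adherent d0 supE.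
  exists m; have [_ h] := BP k m; apply: (le_trans h).
  by rewrite lee_fin ler_pdivrMr//; rewrite -/L in Lm; lra.
move=> w Hw; apply: cvg_of_rational_cauchy; first exact: N_rc.
move=> k; have [m nB] := Hw k; exists m => n.
have : ~~ (e k <= (N (rational_time m n) w - N m%:R w) ^+ 2).
  by apply/negP => h; apply: nB; exists n.
rewrite -ltNge => /ltW; rewrite -[leLHS]real_normK ?num_real//.
by rewrite ler_pXn2r ?nnegrE// invr_ge0.
Qed.

End bounded.
End martingale.
End bounded_martingales.

(** * Convergence from Laplace transforms *)

Section laplace_limit.
Context d (Omega : measurableType d) (R : realType) (P : probability Omega R).
Variable Z : R -> Omega -> R.
Hypothesis mZ : forall t, measurable_fun setT (Z t).
Hypothesis Z_ge0 : forall t w, 0 <= t -> 0 <= Z t w.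
Hypothesis expZ_cvg : {ae P, forall w, cvg (expR (- Z t w) @[t --> +oo])}.
Variable L : R -> R.
Hypothesis laplace_cvg : forall theta, 0 < theta ->
  Rintegral P setT (fun w => expR (- (theta * Z n%:R w))) @[n --> \oo] --> L theta.
Hypothesis laplace0 : forall e, 0 < e -> exists2 theta, 0 < theta & 1 - e <= L theta.

Let S (n : nat) w := expR (- Z n%:R w).
(** An upper limit over integer times is measurable and defined everywhere, and it equals the limit
    over real times wherever the latter exists. *)
Let l w := limn_sup (S ^~ w).

Let S01 n w : 0 < S n w <= 1.
Proof. by rewrite expR_gt0 expR_le1 oppr_le0 Z_ge0. Qed.

Let expS theta n w : 0 <= theta -> 0 <= expR (- (theta * Z n%:R w)) <= 1.
Proof. by move=> t0; rewrite expR_ge0 expR_le1 oppr_le0 mulr_ge0 ?Z_ge0. Qed.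

Let ml : measurable_fun setT l.
Proof.
apply: measurable_fun_limn_sup.
- by move=> w _; exists 1 => _ [n _ <-]; have /andP[] := S01 n w.
- by move=> w _; exists 0 => _ [n _ <-]; have /andP[/ltW] := S01 n w.
- by move=> n; do 2 apply: measurableT_comp => //.
Qed.

Let mexp theta n : measurable_fun setT (fun w => expR (- (theta * Z n%:R w))).
Proof. by do 2 apply: measurableT_comp => //; exact: measurable_funM. Qed.

Let S_cvg w : cvg (expR (- Z t w) @[t --> +oo]) -> expR (- Z t w) @[t --> +oo] --> l w.
Proof.
move=> /cvg_ex[/= a ha]; suff -> : l w = a by [].
have h : S n w @[n --> \oo] --> a by exact: (cvg_comp _ _ (@cvgr_idn R) ha).
by have [_] := cvg_limn_inf_sup h.
Qed.

(** On the event [l = 0] the variables [Z] tend to infinity, so this event contributes nothing to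
    the limit of the Laplace transforms: [L theta <= 1 - P A]. Since [L theta] can be brought above
    [1 - e], the probability is at most [e]. *)
Let limit_zero_null : P [set w | l w = 0] = 0%E.
Proof.
have mA : measurable [set w | l w = 0].
  by have := ml measurableT [set 0] (measurable_set1 _); rewrite setTI.
apply/eqP; rewrite eq_le measure_ge0 andbT; apply/lee_addgt0Pr => e e0; rewrite add0e.
have [theta th0 hL] := laplace0 e e0.
set A := [set w | l w = 0] in mA *.
have iA B : measurable B -> forall n,
    P.-integrable B (EFin \o (fun w => expR (- (theta * Z n%:R w)))).
  move=> mB n; apply: (bounded_integrable _ _ _ _ 1) => // w.
  by have /andP[h1 h2] := expS theta n w (ltW th0); rewrite ger0_norm.
have A_cvg : Rintegral P A (fun w => expR (- (theta * Z n%:R w))) @[n --> \oo] --> 0.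
  have [] := @dominated_convergence _ _ _ P A mA
    (fun n => EFin \o (fun w => expR (- (theta * Z n%:R w)))) (cst 0%E) (cst 1%E).
  - by move=> n; apply/measurable_EFinP; exact: measurable_funTS.
  - exact: measurable_cst.
  - apply: filterS expZ_cvg => w /S_cvg + Aw; rewrite Aw => Sw.
    apply: cvg_EFin; first by near=> n.
    apply/(@cvgrPdist_le _ R^o) => eta eta0.
    (* The threshold is [eta] to the power [1 / theta]: below it, [expR (- (theta * Z))] is at most
       [eta]. *)
    have /(@cvgrPdist_le _ R^o)/(_ _ (expR_gt0 (ln eta / theta))) := cvg_comp _ _ (@cvgr_idn R) Sw.
    apply: filterS => n; rewrite !sub0r !normrN !gtr0_norm ?expR_gt0//= ler_expR.
    rewrite ler_pdivlMr// => h; rewrite -[leRHS]lnK ?posrE// ler_expR; lra.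
  - by apply: (bounded_integrable _ _ _ _ 1 (cst 1)) => // w; rewrite normr1.
  - apply: aeW => w n _; rewrite /= lee_fin.
    by have /andP[h1 h2] := expS theta n w (ltW th0); rewrite ger0_norm.
  - move=> _ _; rewrite integral0 => /fine_cvgP[_]; exact.
have PA : P A \is a fin_num by exact: fin_num_measure.
rewrite -(fineK PA) lee_fin.
suff : L theta <= 0 + (1 - fine (P A)) by lra.
have mAC := measurableC mA.
have h : (Rintegral P A (fun w => expR (- (theta * Z n%:R w))) + (1 - fine (P A)))
    @[n --> \oo] --> 0 + (1 - fine (P A)).
  by apply: cvgD A_cvg _; exact: cvg_cst.
apply: (ler_cvg_to (laplace_cvg theta th0) h); near=> n.
rewrite -[X in Rintegral P X _](setvU A) setUC Rintegral_setU//; last 2 first.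
- by rewrite setUv; exact: iA.
- by apply/disj_setPS => w [].
rewrite lerD2l.
have -> : 1 - fine (P A) = Rintegral P (~` A) (cst 1).
  rewrite Rintegral_cst// mul1r.
  have := probability_setC P mA => /(congr1 fine) ->.
  by rewrite fineB//= .
apply: (le_Rintegral_bounded _ _ _ P 1) => //.
- by move=> w; have /andP[h1 h2] := expS theta n w (ltW th0); rewrite ger0_norm.
- by move=> w; rewrite /= normr1.
- by move=> w _; have /andP[] := expS theta n w (ltW th0).
Unshelve. all: by end_near. Qed.

Lemma laplace_limit : exists W : Omega -> R,
  [/\ measurable_fun setT W,
      {ae P, forall w, Z t w @[t --> +oo] --> W w} &
      forall theta, 0 < theta ->
        (\int[P]_w (expR (- (theta * W w)))%:E = (L theta)%:E)%E].
Proof.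
(* This is real-valued everywhere; the conventional value of [ln] at 0 is taken only on a null
   event. *)
pose W w := - ln (l w).
have mW : measurable_fun setT W.
  by apply: measurableT_comp => //; apply: measurableT_comp ml => //; exact: measurable_ln.
have mA : measurable [set w | l w = 0].
  by have := ml measurableT [set 0] (measurable_set1 _); rewrite setTI.
have l_neq0 : {ae P, forall w, l w <> 0}.
  exists [set w | l w = 0]; split => // w /= /contrapT; exact.
have Z_cvg : {ae P, forall w, Z t w @[t --> +oo] --> W w}.
  apply: filterS2 expZ_cvg l_neq0 => w /S_cvg Sw lw0.
  have l0 : 0 < l w.
    rewrite lt_neqAle eq_sym; apply/andP; split; first exact/eqP.
    apply: (ler_cvg_to (cvg_cst 0) Sw); near=> t; exact: expR_ge0.
  have -> : (fun t => Z t w) = (fun t => - ln (expR (- Z t w))).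
    by apply/funext => t; rewrite expRK opprK.
  apply: cvgN; apply: (@cvg_comp _ _ _ (fun t => expR (- Z t w)) (@ln R) _ (nbhs (l w))).
    exact: Sw.
  exact: continuous_ln.
exists W; split => // theta th0.
have [] := @dominated_convergence _ _ _ P setT measurableT
    (fun n => EFin \o (fun w => expR (- (theta * Z n%:R w))))
    (EFin \o (fun w => expR (- (theta * W w)))) (cst 1%E).
- by move=> n; apply/measurable_EFinP.
- apply/measurable_EFinP; do 2 apply: measurableT_comp => //; exact: measurable_funM.
- apply: filterS Z_cvg => w Zw _.
  apply: cvg_EFin; first by near=> n.
  have h := cvg_comp _ _ (@cvgr_idn R) Zw.
  apply: (@cvg_comp _ _ _ (fun n : nat => - (theta * Z n%:R w)) (@expR R) _
    (nbhs (- (theta * W w)))); last exact: continuous_expR.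
  by apply: cvgN; apply: cvgM h; exact: cvg_cst.
- by apply: (bounded_integrable _ _ _ _ 1 (cst 1)) => // w; rewrite normr1.
- apply: aeW => w n _; rewrite /= lee_fin.
  by have /andP[h1 h2] := expS theta n w (ltW th0); rewrite ger0_norm.
move=> iW _ h.
have h1 : (L theta)%:E = lim ((\int[P]_w (expR (- (theta * Z n%:R w)))%:E)%E @[n --> \oo]).
  apply/esym/cvg_lim => //.
  have -> : (fun n : nat => \int[P]_w (expR (- (theta * Z n%:R w)))%:E)%E =
      (fun n : nat => (Rintegral P setT (fun w => expR (- (theta * Z n%:R w))))%:E).
    apply/funext => n; rewrite /Rintegral fineK//.
    apply: integrable_fin_num => //; apply: (bounded_integrable _ _ _ _ 1) => // w.
    by have /andP[k1 k2] := expS theta n w (ltW th0); rewrite ger0_norm.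
  by apply: cvg_EFin; [near=> n|exact: laplace_cvg].
by rewrite h1; apply/esym/cvg_lim.
Unshelve. all: by end_near. Qed.

End laplace_limit.

(** * The martingale of the process *)

Lemma measurable_expRN d (T : measurableType d) (R : realType) (f : T -> R) :
  measurable_fun setT f -> measurable_fun setT (fun w => expR (- f w)).
Proof. by move=> mf; do 2 apply: measurableT_comp => //. Qed.

Section cbi.
Context {R : realType}.
Variables (phi psi : R -> R) (v : R -> R -> R).
Hypothesis phi_cont : forall q, 0 < q -> {for q, continuous phi}.
Hypothesis phi_gt0 : forall q, 0 < q -> 0 < phi q.
Hypothesis psi0 : psi 0 = 0.
Hypothesis psi_lip : locally_lipschitz_pos psi.
Hypothesis v0 : forall p, 0 <= p -> v 0 p = p.
Hypothesis v_sol : forall p, 0 <= p -> ode_solution psi (v^~ p).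
Variables (d : measure_display) (Omega : measurableType d) (P : probability Omega R).
Variables (x : R) (x0 : 0 <= x) (Y : R -> Omega -> R).
Hypothesis HY : is_CBI P phi v x Y.
Variable lam : R.
Hypothesis lam_sub : subcritical psi lam.
Implicit Types (s t : R) (w : Omega).

Local Notation leb := (@lebesgue_measure R).
Local Notation h := (fun t => vinv v t lam).
Local Notation K := (immigration_exponent phi psi v lam).

Let vinvP := vinvP psi v psi0 psi_lip v0 v_sol lam lam_sub.

Let gen s : set (set Omega) :=
  [set A | exists r B, 0 <= r <= s /\ measurable B /\ A = Y r @^-1` B].

Let mY t : measurable_fun setT (Y t).
Proof. by case: HY. Qed.

Let Y_ge0 t w : 0 <= t -> 0 <= Y t w.
Proof. by case: HY => _ + _ _ _; exact. Qed.

Let gen_measurable t : gen t `<=` measurable.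
Proof.
move=> _ [r [B [_ [mB ->]]]].
by have := mY r measurableT B mB; rewrite setTI.
Qed.

Let gen_le s t : s <= t -> gen s `<=` gen t.
Proof.
move=> st A [r [B [/andP[r0 rs] H]]]; exists r, B; split => //.
by rewrite r0 (le_trans rs).
Qed.

Let Y_adapted t : 0 <= t -> adapted _ _ _ gen t (Y t).
Proof.
move=> t0 _ B mB; rewrite setTI; apply: sub_sigma_algebra.
by exists t, B; rewrite t0 lexx.
Qed.

Let hY_ge0 t w : 0 <= t -> 0 <= h t * Y t w.
Proof.
by move=> t0; have [/andP[h0 _] _] := vinvP t t0; rewrite mulr_ge0 ?Y_ge0// ltW.
Qed.

Definition cbi_martingale t w := expR (K t) * expR (- (h t * Y t w)).
Local Notation N := cbi_martingale.

Lemma cbi_martingale_bound t w : 0 <= t -> 0 <= N t w <= expR (K t).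
Proof.
move=> t0; rewrite mulr_ge0 ?expR_ge0//= ler_piMr ?expR_ge0//.
by rewrite expR_le1 oppr_le0 hY_ge0.
Qed.

Lemma cbi_martingale_adapted t : 0 <= t -> adapted _ _ _ gen t (N t).
Proof.
move=> t0; apply: measurable_funM => //.
apply: measurable_expRN; apply: measurable_funM => //; exact: Y_adapted.
Qed.

(** The transition formula over time [t - s] is taken at parameter [h t]. The flow returns [h t] to
    [h s], and the immigration integral is [K t - K s], exactly what the prefactor [expR (K t)]
    compensates. *)
Lemma cbi_martingaleP s t A : 0 <= s -> s <= t -> <<s gen s >> A ->
  Rintegral P A (N s) = Rintegral P A (N t).
Proof.
move=> s0 st FA; have r0 : 0 <= t - s by lra.
have t0 := le_trans s0 st.
have [/andP[ht0 _] _] := vinvP t t0.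
have mA := past_measurable _ _ _ gen gen_measurable s A FA.
have iS r : 0 <= r -> P.-integrable A (EFin \o (fun w => expR (- (h r * Y r w)))).
  move=> rr0; apply: (bounded_integrable _ _ _ _ 1) => //.
    by apply: measurable_expRN; exact: measurable_funM.
  by move=> w; rewrite ger0_norm ?expR_ge0// expR_le1 oppr_le0 hY_ge0.
have E : Rintegral P A (fun w => expR (- (h t * Y t w))) =
    Rintegral P A (fun w => expR (- (K t - K s)) * expR (- (h s * Y s w))).
  case: HY => _ _ _ _ /(_ s (t - s) (h t) A s0 r0 (ltW ht0) FA) /(congr1 fine).
  have ts : t = s + (t - s) by ring.
  rewrite -ts => e; rewrite /Rintegral e; congr fine; apply: eq_integral => w _.
  congr EFin; rewrite -expRD; congr expR.
  have -> : v (t - s) (h t) = h s by rewrite {2}ts (flow_vinv psi v).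
  have -> : Rintegral leb `[0, t - s] (fun r => phi (v r (h t))) = K t - K s.
    by rewrite {2}ts (flow_integral_vinv phi psi v)// -ts.
  ring.
rewrite /N !RintegralZl//; [|exact: iS|exact: iS].
rewrite E RintegralZl//; last exact: iS.
by rewrite mulrA -expRD; congr (expR _ * _); ring.
Qed.

Let h_rc t : 0 <= t -> h r @[r --> t^'+] --> h t.
Proof.
move=> t0; have hE r : 0 <= r -> h r = vs v (- r) lam.
  by move=> r0; rewrite (orbit_neg psi v).
have oc : {for t, continuous (fun r => vs v (- r) lam)}.
  apply: (@continuous_comp _ _ _ (fun r : R => - r) (fun r => vs v r lam)).
    exact: opp_continuous.
  exact: (orbit_cont psi v psi0 psi_lip v0 v_sol lam lam_sub).
rewrite hE//; apply: cvg_trans (cvg_at_right_filter oc).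
apply: near_eq_cvg; near=> r; rewrite hE//.
have : t < r by near: r; exact: nbhs_right_gt.
lra.
Unshelve. all: by end_near. Qed.

Let Y_rc w t : 0 <= t -> Y r w @[r --> t^'+] --> Y t w.
Proof. by case: HY => _ _ [+ _] _ _; exact. Qed.

Let exp_rc w t : 0 <= t -> expR (- (h r * Y r w)) @[r --> t^'+] --> expR (- (h t * Y t w)).
Proof.
move=> t0; apply: (@cvg_comp _ _ _ (fun r => - (h r * Y r w)) (@expR R) _
  (nbhs (- (h t * Y t w)))); last exact: continuous_expR.
by apply: cvgN; apply: cvgM; [exact: h_rc|exact: Y_rc].
Qed.

Lemma cbi_laplace theta t : 0 <= theta -> 0 <= t ->
  Rintegral P setT (fun w => expR (- (theta * Y t w))) =
  expR (- (x * v t theta) - Rintegral leb `[0, t] (fun r => phi (v r theta))).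
Proof.
move=> th0 t0; case: HY => _ _ _ Y0 /(_ 0 t theta setT (lexx _) t0 th0).
have F0 : natF Y 0 setT by exact: (past_setT _ _ _ gen).
move=> /(_ F0) /(congr1 fine); rewrite add0r /Rintegral => ->.
set c := expR (- (x * _) - _).
transitivity (fine (\int[P]_(w in setT) c%:E)%E).
  congr fine; apply: ae_eq_integral => //.
  - apply/measurable_EFinP; apply: (measurableT_comp (f := @expR R)) => //.
    by apply: measurable_funB => //; apply: measurable_funN; exact: measurable_funM.
  - by apply: filterS Y0 => w /= -> _.
rewrite integral_cst// -[RHS]/(fine c%:E) -[c%:E in RHS]mule1; congr (fine (_ * _)).
exact: probability_setT.
Qed.

Lemma cbi_cvg_infty : (\int[leb]_(u in `]0%R, lam]) (phi u / `|psi u|)%:E = +oo)%E ->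
  {ae P, forall w, h t * Y t w @[t --> +oo] --> +oo}.
Proof.
move=> Foo.
have Kinf := immigration_exponent_infty phi psi v phi_cont phi_gt0 psi0 psi_lip
  v0 v_sol lam lam_sub Foo.
have expK_cvg : expR (- K t) @[t --> +oo] --> 0.
  apply/(@cvgrPdist_le _ R^o) => e e0; have [T T0 KT] := Kinf (- ln e).
  near=> t; rewrite sub0r normrN gtr0_norm ?expR_gt0//.
  rewrite -[leRHS]lnK ?posrE// ler_expR lerNl; apply: KT.
  by near: t; apply: nbhs_pinfty_ge; exact: num_real.
have SE w t : expR (- K t) * N t w = expR (- (h t * Y t w)).
  by rewrite /N mulrA -expRD addNr expR0 mul1r.
have H : {ae P, forall w, expR (- K t) * N t w @[t --> +oo] --> 0}.
  apply: (damped_martingale_cvg0 _ _ _ P gen gen_measurable gen_le N (fun t => expR (K t))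
    cbi_martingale_bound cbi_martingale_adapted cbi_martingaleP (fun t => expR (- K t))) => //.
  - by move=> t _; exact: expR_gt0.
  - move=> s t s0 st; rewrite ler_expR lerN2.
    exact: (immigration_exponent_le phi psi v phi_cont phi_gt0 psi0 psi_lip v0 v_sol).
  - by move=> w t t0; under eq_fun do rewrite SE; rewrite SE; exact: exp_rc.
apply: filterS H => w Hw; apply/cvgryPge => A.
move/(@cvgrPdist_le _ R^o) : Hw => /(_ _ (expR_gt0 (- A))); apply: filterS => t.
by rewrite sub0r normrN SE gtr0_norm ?expR_gt0// ler_expR lerN2.
Unshelve. all: by end_near. Qed.

Section finite_exponent.
Hypothesis F_int : exists e, 0 < e /\
  (\int[leb]_(u in `]0%R, e]) (phi u / `|psi u|)%:E < +oo)%E.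
Variable b : R.
Hypothesis b0 : b < 0.
Hypothesis psi_near0 : forall e, 0 < e ->
  exists2 r, 0 < r & forall q, 0 < q -> q <= r -> `|psi q - b * q| <= e * q.

Local Notation G z := (Rintegral leb `[0, z] (fun u => phi u / `|psi u|)).

Let KE t : 0 <= t -> K t = G lam - G (h t).
Proof.
exact: (immigration_exponentE phi psi v phi_cont phi_gt0 psi0 psi_lip v0 v_sol
  lam lam_sub F_int).
Qed.

Let K_rc t : 0 <= t -> K r @[r --> t^'+] --> K t.
Proof.
move=> t0; have [/andP[ht0 htl] _] := vinvP t t0.
(* At [t = 0] the point [h t] is [lam] itself, so the integral has to be continuous on an interval
   reaching beyond [lam]. *)
have s1 : subcritical psi (vs v 1 lam) by exact: (orbit_sub psi v).
have l1 : lam < vs v 1 lam.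
  have := orbit_lt psi v psi0 psi_lip v0 v_sol lam lam_sub 0 1 ltr01.
  by rewrite {1}/vs lexx v0//; case: lam_sub => /ltW.
have [u0 _] := s1.
have Gc : {for h t, continuous (fun y : R => G y)}.
  apply: (within_continuous_continuous u0
    (ratio_integral_continuous phi psi phi_cont phi_gt0 psi_lip F_int _ s1)).
  by rewrite in_itv/= ht0 (le_lt_trans htl).
rewrite KE//; have H : (G lam - G (h r)) @[r --> t^'+] --> G lam - G (h t).
  apply: cvgB; first exact: cvg_cst.
  exact: (@cvg_comp _ _ _ h (fun y : R => G y) _ (nbhs (h t)) _ (h_rc t t0) Gc).
apply: cvg_trans H; apply: near_eq_cvg; near=> r; rewrite KE//.
have : t < r by near: r; exact: nbhs_right_gt.
lra.
Unshelve. all: by end_near. Qed.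

Let K_cvg : K t @[t --> +oo] --> G lam.
Proof.
have H : (G lam - G (h t)) @[t --> +oo] --> G lam - 0.
  apply: cvgB; first exact: cvg_cst.
  apply: (@cvg_comp _ _ _ h (fun y : R => G y) _ (nbhs 0)).
    exact: (cvg_vinv0 psi v psi0 psi_lip v0 v_sol lam lam_sub).
  exact: (cvg_ratio_integral0 phi psi phi_cont phi_gt0 psi_lip lam lam_sub F_int).
rewrite subr0 in H; apply: cvg_trans H; apply: near_eq_cvg; near=> r.
by rewrite KE//; near: r; apply: nbhs_pinfty_ge.
Unshelve. all: by end_near. Qed.

(** Here [K] is bounded by its limit [G lam], so the martingale is bounded by [expR (G lam)], and
    its limit can be multiplied by that of [expR (- K t)]. *)
Lemma cbi_exp_cvg : {ae P, forall w, cvg (expR (- (h t * Y t w)) @[t --> +oo])}.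
Proof.
have G0 z : 0 < z -> 0 <= G z.
  move=> z0; apply: Rintegral_ge0 => u /=; rewrite in_itv/= => /andP[+ _].
  rewrite le_eqVlt => /predU1P[<-|u0]; last by rewrite divr_ge0// ltW// phi_gt0.
  by rewrite psi0 normr0 invr0 mulr0.
have H : {ae P, forall w, cvg (N t w @[t --> +oo])}.
  apply: (bounded_martingale_cvg _ _ _ P gen gen_measurable gen_le N (fun t => expR (K t))
    cbi_martingale_bound cbi_martingale_adapted cbi_martingaleP (expR (G lam))).
    move=> t t0; rewrite ler_expR KE// gerDl oppr_le0 G0//.
    by have [/andP[]] := vinvP t t0.
  move=> w t t0; apply: cvgM (exp_rc w t t0).
  apply: (@cvg_comp _ _ _ K (@expR R) _ (nbhs (K t))); last exact: continuous_expR.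
  exact: K_rc.
apply: filterS H => w /cvg_ex[/= a Na]; apply/cvg_ex; exists (expR (- G lam) * a).
have -> : (fun t => expR (- (h t * Y t w))) = (fun t => expR (- K t) * N t w).
  by apply/funext => t; rewrite /N mulrA -expRD addNr expR0 mul1r.
apply: cvgM Na.
apply: (@cvg_comp _ _ _ (fun t => - K t) (@expR R) _ (nbhs (- G lam))).
  by apply: cvgN; exact: K_cvg.
exact: continuous_expR.
Qed.

Lemma cbi_limit : exists W : Omega -> R,
  [/\ measurable_fun setT W,
      {ae P, forall w, h t * Y t w @[t --> +oo] --> W w} &
      forall theta, 0 < theta ->
        let V := vs v (- (ln theta / b)) lam in
        (\int[P]_w (expR (- (theta * W w)))%:E = (expR (- (x * V) - G V))%:E)%E].
Proof.
pose L theta := expR (- (x * vs v (- (ln theta / b)) lam) - G (vs v (- (ln theta / b)) lam)).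
apply: (laplace_limit _ _ _ P (fun t w => h t * Y t w) _ _ cbi_exp_cvg L).
- by move=> t; exact: measurable_funM.
- exact: hY_ge0.
- move=> theta th0.
  have H : expR (- (x * v t (theta * h t)) -
      Rintegral leb `[0, t] (fun r => phi (v r (theta * h t)))) @[t --> +oo] --> L theta.
    apply: (@cvg_comp _ _ _ (fun t => - (x * v t (theta * h t)) -
      Rintegral leb `[0, t] (fun r => phi (v r (theta * h t)))) (@expR R) _
      (nbhs (- (x * vs v (- (ln theta / b)) lam) - G (vs v (- (ln theta / b)) lam))));
      last exact: continuous_expR.
    apply: cvgB; last first.
      exact: (cvg_flow_integral phi psi v phi_cont phi_gt0 psi0 psi_lip v0 v_sol
        lam lam_sub F_int b b0 psi_near0 theta th0).
    apply: cvgN; apply: cvgM; first exact: cvg_cst.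
    exact: (cvg_orbit_scaled psi v psi0 psi_lip v0 v_sol lam lam_sub b b0 psi_near0).
  have := cvg_comp _ _ (@cvgr_idn R) H; apply: cvg_trans.
  apply: near_eq_cvg; near=> n; rewrite /=.
  have [/andP[h0 _] _] := vinvP n%:R (ler0n _ _).
  rewrite -cbi_laplace//; last by rewrite mulr_ge0 ?ltW.
  by apply: eq_Rintegral => w _; rewrite mulrA.
- move=> e e0.
  have [theta th0 Le] := small_exponent phi psi v phi_cont phi_gt0 psi0 psi_lip v0 v_sol
    lam lam_sub F_int b b0 x e x0 e0.
  exists theta => //; rewrite /L.
  have := expR_ge1Dx (- (x * vs v (- (ln theta / b)) lam) - G (vs v (- (ln theta / b)) lam)).
  by apply: le_trans; move: Le => /=; rewrite -opprD lerD2l lerN2.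
Unshelve. all: by end_near. Qed.

End finite_exponent.
End cbi.

Theorem theorem2
  (R : realType) (sigma b beta : R) (pi nu : {measure set R -> \bar R})
  (hsigma : 0 <= sigma) (hbeta : 0 <= beta)
  (hpi_supp : pi [set u : R | (u <= 0)%R] = 0%E)
  (hnu_supp : nu [set u : R | (u <= 0)%R] = 0%E)
  (hpi_sf : sigma_finite [set u : R | (0 < u)%R] pi)
  (hnu_sf : sigma_finite [set u : R | (0 < u)%R] nu)
  (hpi_int : (\int[pi]_(z in [set u : R | (0 < u)%R]) (Num.min z (z ^+ 2))%:E < +oo)%E)
  (hnu_int : (\int[nu]_(z in [set u : R | (0 < u)%R]) (Num.min 1 z)%:E < +oo)%E)
  (hPhi_pos : forall q : R, 0 < q -> 0 < Phi beta nu q)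
  (hb : b < 0)
  (v : R -> R -> R)
  (hv0 : forall lam : R, 0 <= lam -> v 0 lam = lam)
  (hv_nonneg : forall t lam : R, 0 <= t -> 0 <= lam -> 0 <= v t lam)
  (hv_cont : forall lam : R, 0 <= lam -> {within `[0, +oo[, continuous (v^~ lam)})
  (hv_ode : forall t lam : R, 0 < t -> 0 <= lam ->
     is_derive t 1 (v^~ lam) (- Psi sigma b pi (v t lam)))
  (d : measure_display) (Omega : measurableType d) (P : probability Omega R)
  (x : R) (hx : 0 <= x) (Y : R -> Omega -> R)
  (hY : is_CBI P (Phi beta nu) v x Y)
  (lam : R) (hlam0 : 0 < lam) (hlamrho : (lam%:E < rho_of (Psi sigma b pi))%E) :
  ((exists e : R, 0 < e /\
      (\int[lebesgue_measure]_(u in `]0%R, e]) (Phi beta nu u / `|Psi sigma b pi u|)%:E < +oo)%E) ->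
    exists W : Omega -> R,
      [/\ measurable_fun setT W,
          {ae P, forall w, (fun t => vinv v t lam * Y t w) @ +oo --> W w},
          ~ {ae P, forall w, W w = 0} &
          forall theta : R, 0 < theta ->
            let V := vs v (- (ln theta / b)) lam in
            (\int[P]_w (expR (- (theta * W w)))%:E =
             (expR (- (x * V) + Rintegral lebesgue_measure `[0%R, V]
                       (fun u => Phi beta nu u / Psi sigma b pi u)))%:E)%E])
  /\
  ((forall e : R, 0 < e ->
      (\int[lebesgue_measure]_(u in `]0%R, e]) (Phi beta nu u / `|Psi sigma b pi u|)%:E = +oo)%E) ->
    {ae P, forall w, (fun t => vinv v t lam * Y t w) @ +oo --> +oo}).
Proof.
pose psi := Psi sigma b pi; pose phi := Phi beta nu.
have psi0 : psi 0 = 0 := Psi_0 pi sigma b.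
have psi_lip : locally_lipschitz_pos psi := Psi_lip pi hpi_int sigma b.
have psi_near0 := Psi_near0 pi hpi_int sigma b.
have phi_cont q : 0 < q -> {for q, continuous phi} := Phi_continuous nu hnu_int beta q.
have v_sol p : 0 <= p -> ode_solution psi (v^~ p).
  move=> p0; split => [|t t0|t t0]; [exact: hv_cont|exact: hv_ode|exact: hv_nonneg].
have lam_sub : subcritical psi lam.
  split => // z /andP[z0 zl]; rewrite ltNge; apply/negP => pz.
  have : (rho_of psi <= z%:E)%E by apply: ereal_inf_lbound; exists z.
  by rewrite leNgt (le_lt_trans _ hlamrho)// lee_fin.
split=> [F_int|Foo]; last first.
  by apply: (cbi_cvg_infty phi psi v phi_cont hPhi_pos psi0 psi_lip hv0 v_sol _ _ P x Y
    hY lam lam_sub); exact: Foo.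
have [W [mW Wcvg WL]] := cbi_limit phi psi v phi_cont hPhi_pos psi0 psi_lip hv0 v_sol
  _ _ P x hx Y hY lam lam_sub F_int b hb psi_near0.
have sV s : subcritical psi (vs v s lam) by exact: (orbit_sub psi v).
exists W; split => //.
(* If [W] vanished almost surely, its Laplace transform at 1 would be 1, whereas the exponent
   [- (x * V) - G V] is negative because the integral is positive. *)
- move=> W0; have := WL 1 ltr01; cbv zeta; set V := vs _ _ _.
  have V0 : 0 < V by have [] := sV (- (ln 1 / b)).
  have GV := ratio_integral_gt0 phi psi phi_cont hPhi_pos psi0 psi_lip F_int V (sV _).
  have -> : (\int[P]_w (expR (- (1 * W w)))%:E = 1)%E.
    transitivity (\int[P]_(w in setT) (cst 1%E w))%E.
      apply: ae_eq_integral => //.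
        by apply/measurable_EFinP; apply: measurable_expRN; exact: measurable_funM.
      by apply: filterS W0 => w /= -> _; rewrite mulr0 oppr0 expR0.
    rewrite integral_cst// mul1e; exact: probability_setT.
  move=> [] /esym/eqP; rewrite lt_eqF// expR_lt1.
  by have := mulr_ge0 hx (ltW V0); lra.
- move=> theta th0 V; rewrite WL// -/V; congr (expR (_ + _))%:E.
  have iV := ratio_integrable0 phi psi phi_cont hPhi_pos psi_lip F_int V (sV _).
  (* On []0, V]] the mechanism is negative, so dividing by [psi] instead of its absolute value
     changes the sign of the integral; at 0 both quotients are 0. *)
  rewrite -mulN1r -RintegralZl//; apply: eq_Rintegral => u /set_mem/=.
  rewrite in_itv/= => /andP[+ uV]; rewrite le_eqVlt => /predU1P[<-|u0].
    by rewrite -/(psi 0) psi0 normr0 !invr0 !mulr0.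
  have pu : psi u < 0 by apply: subcritical_psi; exact: subcritical_le (sV _) u0 uV.
  by rewrite -/(psi u) ltr0_norm// invrN mulrN mulN1r opprK.
Qed.
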